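(* Let $a,b\in\mathbb{C}$ be distinct, let $U=\mathbb{C}\setminus\{a,b\}$ and let $K$ be a compact set in $U$. Then there exist a constant $C$, depending only on $\sup_{w\in K}\{|w-a|,|w-b|\}$, $d(K,\{a,b\})$ and $|a-b|$, and a number $\varepsilon_0>0$ such that for every $0<\varepsilon<\varepsilon_0$ and all $a',b'\in\mathbb{C}$ with $H(\{a,b\},\{a',b'\})<\varepsilon$, one has $$|\rho_{a,b}(z)-\rho_{a',b'}(z)|<C\,\varepsilon\log\left(\frac1\varepsilon\right)\qquad\text{for all } z\in K.$$
   Context: All distances are Euclidean. For sets $A,B\subset\mathbb{C}$, $d(A,B)=\inf_{z\in A,\,w\in B}|z-w|$, and the Hausdorff distance is $H(A,B)=\inf\{r>0: A\subseteq N_r(B)\text{ and }B\subseteq N_r(A)\}$, where $N_r(A)$ is the set of points whose distance from $A$ is less than $r$. For a hyperbolic domain $A$ and $z\in A$, $\rho_A(z)$ denotes the hyperbolic density normalized to have curvature $-4$, i.e. $\rho_A(z)=1/|\pi'(0)|$, where $\pi$ is a holomorphic covering map from the unit disc $\mathbb{D}$ onto $A$ with $\pi(0)=z$. For distinct $a,b\in\mathbb{C}$, $\rho_{a,b}$ denotes the hyperbolic density of $\mathbb{C}\setminus\{a,b\}$ (equivalently of $\hat{\mathbb{C}}\setminus\{a,b,\infty\}$). *)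

(* Defs.v *)
(* The complex plane is R[i], for R : realType. *)
From HB Require Import structures.
From mathcomp Require Import all_boot all_order all_algebra.
From mathcomp Require Import all_classical all_reals all_analysis.
From mathcomp Require Export complex.
Set Implicit Arguments.
Unset Strict Implicit.
Unset Printing Implicit Defensive.
Import Order.TTheory GRing.Theory Num.Theory numFieldNormedType.Exports.
Import ComplexField.Normc.
Local Open Scope classical_set_scope.
Local Open Scope ring_scope.

(* Makes the concrete type R[i] a normed space over itself, exactly as
   numFieldNormedType does for an abstract numFieldType. *)
#[export, non_forgetful_inheritance]
HB.instance Definition _ (R : realType) := NormedModule.copy R[i] (R[i])^o.

Section Metric.
Variable R : realType.
Implicit Types A B : set R[i].

(* [normc] is the real-valued modulus; [`|z|] would land in R[i]. *)
Definition set_dist A B : R := inf [set normc (z - w) | z in A & w in B].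

Definition set_nbhd (r : R) A : set R[i] :=
  [set z | set_dist [set z] A < r].

Definition hausdorff_dist A B : R :=
  inf [set r | [/\ 0 < r, A `<=` set_nbhd r B & B `<=` set_nbhd r A]].

End Metric.

Section Covering.
Variables T S : topologicalType.
Implicit Types (U D : set T) (V A : set S) (p : T -> S).

Definition homeo_on U V p :=
  [/\ set_bij U V p, {within U, continuous p} &
      exists2 g : S -> T, {within V, continuous g} & {in U, cancel p g}].

(* Covering map from D onto A.  D and A are meant to be open, so that "open"
   below agrees with relatively open in D, respectively in A. *)
Definition covering_map D A p :=
  [/\ {within D, continuous p}, p @` D = A &
      forall y, A y -> exists V, [/\ open V, V y, V `<=` A &
        exists F : set (set T),
          [/\ forall U, F U -> open U /\ homeo_on U V p,
              trivIset F id &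
              D `&` p @^-1` V = \bigcup_(U in F) U]]].

End Covering.

Section Hyperbolic.
Variable R : realType.

Definition holomorphic_on (D : set R[i]) (f : R[i] -> R[i]) :=
  forall z, D z -> derivable f z 1.

Definition unit_disc : set R[i] := [set z | normc z < 1].

(* Curvature -4 normalization.  The value does not depend on the choice of pi;
   it is the junk value 0 when there is no such covering, e.g. for z \notin A. *)
Definition hyperbolic_density (A : set R[i]) (z : R[i]) : R :=
  xget 0 [set r | exists pi : R[i] -> R[i],
    [/\ holomorphic_on unit_disc pi, covering_map unit_disc A pi,
        pi 0 = z & r = 1 / normc (derive1 pi 0)]].

Definition rho (a b : R[i]) : R[i] -> R :=
  hyperbolic_density (~` [set a; b]).

End Hyperbolic.

(* Main.v *)
(* If there is no holomorphic covering of C \ {a, b} by the disc, then there is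
   none of C \ {a', b'} either, and both densities are 0.  Otherwise let p be a
   covering of A = C \ {a, b} with p 0 = z, let the disc of radius d about z be
   contained in A, and lift x |-> z + d x through p to a holomorphic self-map g
   of the unit disc with g 0 = 0.  Composing p with a Moebius map of the disc
   moves the base point to p (g x) = z + d x, and composing with the affine map
   sending a, b to a', b' (with linear coefficient l) gives a covering of
   C \ {a', b'}.  With x chosen so that the new base point is again z, the two
   densities are
     |g'(0)| / d   and   |g'(x)| / (d |l| (1 - |g(x)|^2)),
   where x and l - 1 are O(eps).  The Cauchy estimates for g bound the
   difference by a constant times eps, which is better than eps log(1/eps).

   All the complex analysis needed rests on one inequality,
   |f'(c)| <= 24 M / r for |f| <= M on the disc of radius r about c, obtained
   from Goursat's theorem for rectangles.  Applied to translates and difference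
   quotients of f it shows that f' is Lipschitz and differentiable, hence that
   (f z - f c) / (z - c) has a removable singularity; applied to the iterates
   of a self-map of the disc it gives the Schwarz lemma with the sharp constant. *)

(* The change of punctures moves the base point, so densities at two nearby points of one plane have
   to be compared, and p itself comes with no estimates. The lift g is a self-map of the unit disc
   fixing 0, for which all bounds hold with universal constants; d, |a - b| and |z - a| enter only
   through the rescaling, and this gives C its form. A second obstacle is that [covering_map] is
   purely topological: the local inverses of p are only continuous. For g to be holomorphic they
   must be too, which requires p' to have no zeros. Removable singularities and the isolation of
   zeros serve this purpose. The numerical constants are crude, with one exception: the density is
   independent of the covering only if the Schwarz lemma holds with constant exactly 1, because two
   coverings with the same base point are compared in both directions. The logarithm is absorbed by
   keeping eps below 1/e, where log(1/eps) > 1. *)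
Require Import Defs.
From HB Require Import structures.
From mathcomp Require Import all_boot all_order all_algebra.
From mathcomp Require Import all_classical all_reals all_analysis.
From mathcomp Require Import complex.
From mathcomp Require Import ring lra.
Import Order.TTheory GRing.Theory Num.Theory numFieldNormedType.Exports.
Import ComplexField.Normc.
Local Open Scope classical_set_scope.
Local Open Scope ring_scope.
Set Implicit Arguments.
Unset Strict Implicit.
Unset Printing Implicit Defensive.

(** * The modulus and complex differentiability *)

(* A copy of [normc] with a codomain that displays as [R]; it is locked because
   unfolding the square root makes [lra] and [ring] diverge. *)
HB.lock Definition cmod (R : realType) (z : R[i]) : R := normc z.

Section ComplexModulus.
Variable R : realType.
Implicit Types (x y z w : R[i]).

Lemma cmodE z : cmod z = normc z. Proof. by rewrite cmod.unlock. Qed.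

Lemma cmodM z w : cmod (z * w) = cmod z * cmod w.
Proof. by rewrite !cmodE; exact: normcM. Qed.

Lemma cmodV z : cmod z^-1 = (cmod z)^-1.
Proof. by rewrite !cmodE; exact: normcV. Qed.

Lemma cmod0 : cmod (0 : R[i]) = 0. Proof. by rewrite cmodE; exact: normc0. Qed.

Lemma cmod1 : cmod (1 : R[i]) = 1. Proof. by rewrite cmodE; exact: normc1. Qed.

Lemma cmod_sqrt (a b : R) : cmod (Complex a b) = Num.sqrt (a ^+ 2 + b ^+ 2).
Proof. by rewrite cmodE. Qed.

Lemma cmod_ge0 z : 0 <= cmod z.
Proof. by case: z => a b; rewrite cmod_sqrt sqrtr_ge0. Qed.

Lemma cmod_eq0 z : (cmod z == 0) = (z == 0).
Proof.
by apply/eqP/eqP => [|->]; [rewrite cmodE; exact: eq0_normc|rewrite cmod0].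
Qed.

Lemma cmod_gt0 z : (0 < cmod z) = (z != 0).
Proof. by rewrite lt_def cmod_ge0 cmod_eq0 andbT. Qed.

Lemma normrcE z : `|z| = (cmod z)%:C%C.
Proof. by rewrite cmodE; case: z. Qed.

Lemma cmod_le_Re z : `|complex.Re z| <= cmod z.
Proof.
by case: z => a b; rewrite cmod_sqrt -sqrtr_sqr ler_wsqrtr// lerDl sqr_ge0.
Qed.

Lemma cmod_le_Im z : `|complex.Im z| <= cmod z.
Proof.
by case: z => a b; rewrite cmod_sqrt -sqrtr_sqr ler_wsqrtr// lerDr sqr_ge0.
Qed.

Lemma cmodD z w : cmod (z + w) <= cmod z + cmod w.
Proof. by have := ler_normD z w; rewrite !normrcE -rmorphD lecR. Qed.

Lemma cmod_opp z : cmod (- z) = cmod z.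
Proof. by rewrite !cmodE; case: z => a b /=; rewrite !sqrrN. Qed.

Lemma cmod_sub z w : cmod (z - w) = cmod (w - z).
Proof. by rewrite -cmod_opp opprB. Qed.

Lemma cmod_real (a : R) : cmod a%:C%C = `|a|.
Proof.
by rewrite cmod_sqrt -sqrtr_sqr; congr Num.sqrt; ring.
Qed.

Lemma cmod_i : cmod ('i%C : R[i]) = 1.
Proof. by rewrite cmod_sqrt -[RHS]sqrtr1; congr Num.sqrt; ring. Qed.

Lemma complexRI (a b : R) : (a +i* b)%C = a%:C%C + 'i%C * b%:C%C.
Proof. by simpc. Qed.

Lemma cmod_le_sum z : cmod z <= `|complex.Re z| + `|complex.Im z|.
Proof.
case: z => a b.
have := cmodD a%:C%C ('i%C * b%:C%C).
by rewrite cmodM !cmod_real cmod_i mul1r -complexRI.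
Qed.

Lemma cmodX z n : cmod (z ^+ n) = cmod z ^+ n.
Proof.
elim: n => [|n IH]; first by rewrite !expr0 cmod1.
by rewrite !exprS cmodM IH.
Qed.

Lemma cmod_dist_trans y x z : cmod (x - z) <= cmod (x - y) + cmod (y - z).
Proof. by rewrite -(subrKA y); exact: cmodD. Qed.

Lemma cmod_ge_sub x z : cmod x - cmod z <= cmod (x - z).
Proof.
by rewrite lerBlDr; apply: le_trans (cmodD _ _); rewrite subrK.
Qed.

Lemma cmod_abs_sub x z : `|cmod x - cmod z| <= cmod (x - z).
Proof.
rewrite ler_norml cmod_ge_sub andbT lerNl opprB cmod_sub.
exact: cmod_ge_sub.
Qed.

(** Balls of [R[i]] have their radii in [R[i]]; positivity forces such a radius to have imaginary
    part 0, so real radii give the same neighbourhoods. *)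
Lemma nbhs_discP z (A : set R[i]) :
  nbhs z A <-> exists2 e : R, 0 < e & forall w, cmod (w - z) < e -> A w.
Proof.
split.
  move/nbhs_ballP => [[e e'] /= ep hA].
  move: ep; rewrite ltcE /= => /andP[/eqP e'0 e0].
  exists e => // w hw; apply: hA.
  by rewrite /ball /= normrcE ltcE /= e'0 eqxx /= cmod_sub.
move=> [e e0 hA]; apply/nbhs_ballP; exists (e%:C%C); first by rewrite /= ltcR.
move=> w; rewrite /ball /= => hw; apply: hA.
by move: hw; rewrite normrcE ltcR cmod_sub.
Qed.

Lemma open_discP (A : set R[i]) :
  open A <-> forall z, A z ->
    exists2 e : R, 0 < e & forall w, cmod (w - z) < e -> A w.
Proof.
by rewrite openE; split=> h z /h; [move/nbhs_discP|move=> ?; apply/nbhs_discP].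
Qed.

(** Continuous induction: around every t there is a window across which P passes from the left of t
    to its right, so P cannot get stuck at a supremum. It yields the mean value inequality as well
    as uniqueness and existence of lifts. *)
Lemma unit_itv_induction (P : R -> Prop) : P 0 ->
  (forall t, 0 <= t <= 1 -> exists2 d, 0 < d &
     forall s s', 0 <= s -> s' <= 1 -> t - d < s -> s <= t -> t <= s' ->
       s' < t + d -> P s -> P s') ->
  P 1.
Proof.
move=> P0 h; pose S := [set t | 0 <= t <= 1 /\ P t].
have S0 : S 0 by rewrite /S /= lexx ler01.
have Sub : has_ubound S by exists 1 => t [/andP[]].
have hS : has_sup S by split; [exists 0|].
have s0 : 0 <= sup S by apply: ub_le_sup.
have s1 : sup S <= 1 by apply: ge_sup; [exists 0|move=> t [/andP[]]].
have /h [d d0 hd] : 0 <= sup S <= 1 by rewrite s0.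
have [s [/andP[s0' s1'] Ps] ds] := sup_adherent d0 hS.
have ss : s <= sup S by apply: ub_le_sup => //; split => //; rewrite s0'.
(* This point lies beyond the supremum unless that is 1; as P holds here, it must be 1. *)
pose s' := Num.min 1 (sup S + d / 2).
have Ps' : P s'.
  apply: hd Ps => //.
  - by rewrite /s' ge_min lexx.
  - by rewrite /s' le_min s1 lerDl; lra.
  - by rewrite /s' gt_min; apply/orP; right; lra.
have : s' <= sup S.
  apply: ub_le_sup => //; split => //.
  by rewrite /s' ge_min lexx /= andbT le_min ler01 /=; lra.
rewrite /s' ge_min => /orP[h1|]; last by lra.
by move: Ps'; rewrite /s' (_ : Num.min _ _ = 1)//; apply/min_idPl; lra.
Qed.

(** The multiplied-out form admits w = z and suits estimates; [cderivI] identifies it with the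
    derivative of the library. *)
Definition cderiv (f : R[i] -> R[i]) z l := forall e : R, 0 < e ->
  exists2 d : R, 0 < d & forall w, cmod (w - z) < d ->
    cmod (f w - f z - l * (w - z)) <= e * cmod (w - z).

Definition ccont (f : R[i] -> R[i]) z := forall e : R, 0 < e ->
  exists2 d : R, 0 < d & forall w, cmod (w - z) < d -> cmod (f w - f z) < e.

Definition disc z (r : R) : set R[i] := [set w | cmod (w - z) < r].

Lemma cderivP (f : R[i] -> R[i]) z :
  derivable f z 1 -> cderiv f z (derive1 f z).
Proof.
move=> df e e0.
have : (fun h => h^-1 *: (f (h + z) - f z)) @ 0^' --> derive1 f z.
  move: df; rewrite derive1E /derivable => /cvg_ex [l hl].
  have <- : (fun h => h^-1 *: ((f \o shift z) (h *: (1 : R[i])) - f z)) =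
            (fun h => h^-1 *: (f (h + z) - f z)).
    by apply/funext => h /=; rewrite /GRing.scale /= mulr1.
  by move/cvgP : (hl) => /cvg_ex; rewrite /derive; move/cvg_lim : (hl) => ->.
move/cvgrPdist_lt => /(_ e%:C%C); rewrite ltcR => /(_ e0).
move/nbhs_discP => [d d0 hd]; exists d => // w wd.
have [->|wz] := eqVneq w z; first by rewrite !subrr mulr0 subr0 cmod0 mulr0.
have wz0 : w - z != 0 by rewrite subr_eq0.
have := hd (w - z); rewrite subr0 => /(_ wd wz0).
rewrite subrK normrcE ltcR => /ltW h; rewrite cmod_sub in h.
have -> : f w - f z - derive1 f z * (w - z) =
    ((w - z)^-1 *: (f w - f z) - derive1 f z) * (w - z).
  rewrite mulrBl; congr (_ - _).
  by rewrite /GRing.scale /= mulrC mulrA divff // mul1r.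
by rewrite cmodM ler_wpM2r ?cmod_ge0.
Qed.

Lemma cderiv_cvg (f : R[i] -> R[i]) z l : cderiv f z l ->
  (fun h => h^-1 *: ((f \o shift z) (h *: (1 : R[i])) - f z)) @ 0^' --> l.
Proof.
move=> df; apply/cvgrPdist_lt => e.
case: e => e e'; rewrite ltcE /= => /andP[/eqP -> e0].
have [d d0 hd] := df _ (divr_gt0 e0 (ltr0n R 2)).
apply/nbhs_discP; exists d => // h; rewrite subr0 => hd0 h0 /=.
have := hd (h + z); rewrite addrK => /(_ hd0) H.
rewrite normrcE ltcR /GRing.scale /= mulr1 cmod_sub.
have n0 : 0 < cmod h by rewrite cmod_gt0.
have -> : h^-1 * (f (h + z) - f z) - l = h^-1 * (f (h + z) - f z - l * h).
  by field; exact: h0.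
rewrite cmodM cmodV mulrC ltr_pdivrMr //; nra.
Qed.

Lemma cderiv_derivable (f : R[i] -> R[i]) z l :
  cderiv f z l -> derivable f z 1 /\ derive1 f z = l.
Proof.
move=> /cderiv_cvg h; split; first by apply/cvg_ex; exists l.
by rewrite derive1E; apply/cvg_lim => //; exact: h.
Qed.

Lemma within_ccont (A : set R[i]) (f : R[i] -> R[i]) : open A ->
  {within A, continuous f} <-> forall z, A z -> ccont f z.
Proof.
move=> oA.
have cE z : {for z, continuous f} <-> ccont f z.
  split=> [h e e0|h].
    have /(_ e%:C%C) := (@cvgrPdist_lt _ _ _ _ (nbhs_filter z) f (f z)).1 h.
    rewrite ltcR => /(_ e0).
    move/nbhs_discP => [d d0 hd]; exists d => // w /hd.
    by rewrite normrcE ltcR cmod_sub.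
  apply/(@cvgrPdist_lt _ _ _ _ (nbhs_filter z)) => -[e e'].
  rewrite ltcE /= => /andP[/eqP -> e0].
  have [d d0 hd] := h _ e0.
  apply/nbhs_discP; exists d => // w /hd.
  by rewrite normrcE ltcR cmod_sub.
rewrite continuous_open_subspace //; split.
  by move=> h z Az; apply/cE/h/mem_set.
by move=> h z /set_mem Az; apply/cE/h.
Qed.

Implicit Types f g : R[i] -> R[i].

Lemma cderivI f z l : cderiv f z l <-> is_derive (z : R[i]) (1 : R[i]) f l.
Proof.
split.
  by move=> h; have [h1 <-] := cderiv_derivable h; rewrite derive1E; exact: DeriveDef.
by move=> [h1 <-]; rewrite -derive1E; exact: cderivP.
Qed.
Lemma cderivM f g z l m : cderiv f z l -> cderiv g z m ->
  cderiv (fun w => f w * g w) z (f z * m + g z * l).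
Proof. by move=> /cderivI hf /cderivI hg; exact/cderivI. Qed.

Lemma cderivD f g z l m : cderiv f z l -> cderiv g z m ->
  cderiv (fun w => f w + g w) z (l + m).
Proof. by move=> /cderivI hf /cderivI hg; exact/cderivI. Qed.

Lemma cderivN f z l : cderiv f z l -> cderiv (fun w => - f w) z (- l).
Proof. by move=> /cderivI hf; exact/cderivI. Qed.

Lemma cderivC (c : R[i]) z : cderiv (fun=> c) z 0.
Proof. exact/cderivI. Qed.

Lemma cderivId z : cderiv (fun w => w) z 1.
Proof. exact/cderivI. Qed.

Lemma cderivV f z l : f z != 0 -> cderiv f z l ->
  cderiv (fun w => (f w)^-1) z (- (f z)^-2 * l).
Proof.
move=> fz /cderivI [df <-]; apply/cderivI; apply: DeriveDef.
  exact: derivableV.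
exact: deriveV.
Qed.

Lemma cderiv_ccont f z l : cderiv f z l -> ccont f z.
Proof.
move=> hf e e0; have [d d0 h] := hf _ ltr01.
have l0 := cmod_ge0 l.
have k0 : 0 < 2 + cmod l by lra.
exists (Num.min d (e / (2 + cmod l))); first by rewrite lt_min d0 divr_gt0.
move=> w; rewrite lt_min ltr_pdivlMr // => /andP[/h hw we].
have -> : f w - f z = (f w - f z - l * (w - z)) + l * (w - z) by ring.
apply: le_lt_trans (cmodD _ _) _; rewrite cmodM.
have := cmod_ge0 (w - z); nra.
Qed.

Lemma cderiv_comp f g z l m : cderiv f (g z) l -> cderiv g z m ->
  cderiv (fun w => f (g w)) z (l * m).
Proof.
move=> hf hg e e0.
have [d1 d10 h1] := hg _ ltr01.
have l0 := cmod_ge0 l; have m0 := cmod_ge0 m.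
have k0 : 0 < e / (2 * (1 + cmod m)) by apply: divr_gt0; lra.
have [d2 d20 h2] := hf _ k0.
have j0 : 0 < e / (2 * (1 + cmod l)) by apply: divr_gt0; lra.
have [d3 d30 h3] := hg _ j0.
have [d4 d40 h4] := cderiv_ccont hg d20.
exists (Num.min (Num.min d1 d3) d4); first by rewrite !lt_min d10 d30.
move=> w; rewrite !lt_min => /andP[/andP[/h1 w1 /h3 w3] /h4 /h2 w4].
set u := g w - g z in w1 w3 w4 *.
have uw : cmod u <= (1 + cmod m) * cmod (w - z).
  have -> : u = (u - m * (w - z)) + m * (w - z) by ring.
  by apply: le_trans (cmodD _ _) _; rewrite cmodM; lra.
have -> : f (g w) - f (g z) - l * m * (w - z) =
  (f (g w) - f (g z) - l * u) + l * (u - m * (w - z)) by ring.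
apply: le_trans (cmodD _ _) _; rewrite cmodM.
have A1 : e / (2 * (1 + cmod m)) * cmod u <= e / 2 * cmod (w - z).
  apply: le_trans (ler_wpM2l (ltW k0) uw) _.
  by rewrite le_eqVlt; apply/orP; left; apply/eqP; field; lra.
have A2 : cmod l * cmod (u - m * (w - z)) <= e / 2 * cmod (w - z).
  apply: le_trans (ler_wpM2l l0 w3) _.
  have -> : cmod l * (e / (2 * (1 + cmod l)) * cmod (w - z)) =
    (cmod l / (1 + cmod l)) * (e / 2 * cmod (w - z)) by field; lra.
  apply: ler_piMl; first by rewrite mulr_ge0 ?cmod_ge0 //; lra.
  by rewrite ler_pdivrMr; lra.
lra.
Qed.

Lemma cderiv_eq f z l l' : l = l' -> cderiv f z l -> cderiv f z l'.
Proof. by move=> ->. Qed.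

Lemma cderiv_near f g z l d : 0 < d ->
  (forall w, cmod (w - z) < d -> f w = g w) -> cderiv f z l -> cderiv g z l.
Proof.
move=> d0 fg hf e e0; have [d1 d10 h] := hf e e0.
exists (Num.min d d1); first by rewrite lt_min d0.
move=> w; rewrite lt_min => /andP[wd wd1].
by rewrite -!fg ?subrr ?cmod0//; exact: h.
Qed.

End ComplexModulus.

(** * Integrals along segments *)

Section Integral.
Variable R : realType.
Implicit Types (a b c M : R) (f g : R -> R).

Definition int1 a b f : R := \int[lebesgue_measure]_(t in `[a, b]) f t.

(** Two-sided continuity at the end points is available because the integrands come from functions
    continuous at points of the plane. *)
Definition cont_on a b f := forall t, a <= t <= b -> {for t, continuous f}.

Lemma cont_on_integrable a b f : cont_on a b f ->
  lebesgue_measure.-integrable `[a, b] (EFin \o f).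
Proof.
move=> cf; apply: continuous_compact_integrable; first exact: segment_compact.
apply: continuous_in_subspaceT => t /set_mem /=; rewrite in_itv /= => /cf.
exact.
Qed.

Lemma cont_on_cst a b c : cont_on a b (fun=> c).
Proof. by move=> t _; exact: cst_continuous. Qed.

Lemma int1D a b f g : cont_on a b f -> cont_on a b g ->
  int1 a b (fun t => f t + g t) = int1 a b f + int1 a b g.
Proof. by move=> cf cg; rewrite /int1 RintegralD//; exact: cont_on_integrable. Qed.

Lemma int1_cst a b c : a <= b -> int1 a b (fun=> c) = c * (b - a).
Proof.
move=> ab; rewrite /int1 Rintegral_cst //= lebesgue_measure_itv /= lte_fin.
case: ltgtP ab => //=; last by move=> ->; rewrite subrr mulr0. 
Qed.

Lemma int1_split a b c f : a <= b -> b <= c -> cont_on a c f ->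
  int1 a c f = int1 a b f + int1 b c f.
Proof.
move=> ab bc cf; have := @Rintegral_itvB R f (BLeft a) (BRight c) b.
move=> /(_ (cont_on_integrable cf)); rewrite !bnd_simp => /(_ ab bc).
rewrite Rintegral_itv_obnd_cbnd; last first.
  have : lebesgue_measure.-integrable `[b, c] (EFin \o f).
    apply: cont_on_integrable => t /andP[h1 h2]; apply: cf.
    by rewrite h2 (le_trans ab).
  by apply: integrableS => //; apply: subset_itvr; rewrite bnd_simp.
by rewrite /int1 => <-; ring.
Qed.

Lemma le_int1 a b f g : cont_on a b f -> cont_on a b g ->
  (forall t, a <= t <= b -> f t <= g t) -> int1 a b f <= int1 a b g.
Proof.
move=> cf cg fg; apply: le_Rintegral => //; try exact: cont_on_integrable.
Qed.

Lemma int1_bound a b f M : a <= b -> cont_on a b f ->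
  (forall t, a <= t <= b -> `|f t| <= M) -> `|int1 a b f| <= M * (b - a).
Proof.
move=> ab cf fM; rewrite ler_norml -mulNr -!(int1_cst _ ab); apply/andP; split.
  by apply: le_int1 => // [|t /fM]; [exact: cont_on_cst|rewrite ler_norml => /andP[]].
by apply: le_int1 => // [|t /fM]; [exact: cont_on_cst|rewrite ler_norml => /andP[]].
Qed.

Implicit Types (phi psi : R -> R[i]).

Definition cint a b phi : R[i] :=
  Complex (int1 a b (fun t => complex.Re (phi t)))
          (int1 a b (fun t => complex.Im (phi t))).

Definition ccont_on a b phi := forall t, a <= t <= b -> forall e, 0 < e ->
  exists2 d, 0 < d & forall s, `|s - t| < d -> cmod (phi s - phi t) < e.

Lemma ccont_on_Re a b phi : ccont_on a b phi ->
  cont_on a b (fun t => complex.Re (phi t)).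
Proof.
move=> h t tab; apply/(@cvgrPdist_lt _ _ _ _ (nbhs_filter t)) => e e0.
have [d d0 hd] := h t tab e e0; apply/nbhs_ballP; exists d => // s.
rewrite /ball /= distrC => /hd; apply: le_lt_trans.
by rewrite distrC; have := cmod_le_Re (phi s - phi t); case: (phi s) (phi t) => ? ? [].
Qed.

Lemma ccont_on_Im a b phi : ccont_on a b phi ->
  cont_on a b (fun t => complex.Im (phi t)).
Proof.
move=> h t tab; apply/(@cvgrPdist_lt _ _ _ _ (nbhs_filter t)) => e e0.
have [d d0 hd] := h t tab e e0; apply/nbhs_ballP; exists d => // s.
rewrite /ball /= distrC => /hd; apply: le_lt_trans.
by rewrite distrC; have := cmod_le_Im (phi s - phi t); case: (phi s) (phi t) => ? ? [].
Qed.

Lemma cintD a b phi psi : ccont_on a b phi -> ccont_on a b psi ->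
  cint a b (fun t => phi t + psi t) = cint a b phi + cint a b psi.
Proof.
move=> hp hq; rewrite /cint.
have E1 : (fun t => complex.Re (phi t + psi t)) =
  (fun t => complex.Re (phi t) + complex.Re (psi t)).
  by apply/funext => t; case: (phi t) (psi t) => ? ? [].
have E2 : (fun t => complex.Im (phi t + psi t)) =
  (fun t => complex.Im (phi t) + complex.Im (psi t)).
  by apply/funext => t; case: (phi t) (psi t) => ? ? [].
rewrite E1 E2 !int1D //; by [exact: ccont_on_Re|exact: ccont_on_Im].
Qed.

Lemma cint_cst a b (k : R[i]) : a <= b -> cint a b (fun=> k) = k * (b - a)%:C%C.
Proof.
by move=> ab; rewrite /cint !int1_cst //; case: k => x y; simpc.
Qed.

Lemma cint_split a b c phi : a <= b -> b <= c -> ccont_on a c phi ->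
  cint a c phi = cint a b phi + cint b c phi.
Proof.
move=> ab bc h; rewrite /cint (int1_split ab bc (ccont_on_Re h)).
by rewrite (int1_split ab bc (ccont_on_Im h)).
Qed.

(** The factor 2 arises from bounding the real and the imaginary part separately. *)
Lemma cint_bound a b phi M : a <= b -> ccont_on a b phi ->
  (forall t, a <= t <= b -> cmod (phi t) <= M) ->
  cmod (cint a b phi) <= 2 * M * (b - a).
Proof.
move=> ab h hM; apply: le_trans (cmod_le_sum _) _ => /=.
have H1 : `|int1 a b (fun t => complex.Re (phi t))| <= M * (b - a).
  apply: int1_bound => // [|t /hM]; first exact: ccont_on_Re.
  by apply: le_trans; exact: cmod_le_Re.
have H2 : `|int1 a b (fun t => complex.Im (phi t))| <= M * (b - a).
  apply: int1_bound => // [|t /hM]; first exact: ccont_on_Im.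
  by apply: le_trans; exact: cmod_le_Im.
by rewrite -mulrA; lra.
Qed.

End Integral.

(** * Goursat's theorem for rectangles *)

Section Goursat.
Variable R : realType.
Implicit Types (a b c M x y e : R) (f g h : R[i] -> R[i]).

Lemma cmod_Complex_le x y : cmod (Complex x y) <= `|x| + `|y|.
Proof. exact: cmod_le_sum. Qed.

Lemma complexB a b x y : Complex a b - Complex x y = Complex (a - x) (b - y).
Proof. by []. Qed.

Lemma cmod_imag x : cmod (Complex 0 x) = `|x|.
Proof. by rewrite cmod_sqrt expr0n add0r sqrtr_sqr. Qed.

Lemma realcB x y : (x - y)%:C%C = x%:C%C - y%:C%C :> R[i].
Proof. by rewrite complexB subrr. Qed.

Definition hcont h y a b := forall x, a <= x <= b -> ccont h (Complex x y).
Definition vcont h x a b := forall y, a <= y <= b -> ccont h (Complex x y).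

Lemma hcontP h y a b : hcont h y a b -> ccont_on a b (fun x => h (Complex x y)).
Proof.
move=> ch t /ch ct e /ct [d d0 hd]; exists d => // s st; apply: hd.
by rewrite complexB subrr cmod_real.
Qed.

Lemma vcontP h x a b : vcont h x a b -> ccont_on a b (fun y => h (Complex x y)).
Proof.
move=> ch t /ch ct e /ct [d d0 hd]; exists d => // s st; apply: hd.
by rewrite complexB subrr cmod_imag.
Qed.

Lemma ccont_onB a b (phi psi : R -> R[i]) :
  ccont_on a b phi -> ccont_on a b psi -> ccont_on a b (fun t => phi t - psi t).
Proof.
move=> hp hq t tab e e0.
have [d1 d10 h1] := hp t tab (e / 2) ltac:(lra).
have [d2 d20 h2] := hq t tab (e / 2) ltac:(lra).
exists (Num.min d1 d2); first by rewrite lt_min d10.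
move=> s; rewrite lt_min => /andP[/h1 a1 /h2 a2].
have -> : phi s - psi s - (phi t - psi t) = (phi s - phi t) + (psi t - psi s) by ring.
by apply: le_lt_trans (cmodD _ _) _; rewrite (cmod_sub (psi t)); lra.
Qed.

(** The counterclockwise integral of h dz along the boundary of the rectangle, with opposite sides
    combined; dz = i dy on the vertical ones. *)
Definition rectint h x0 x1 y0 y1 : R[i] :=
  cint x0 x1 (fun x => h (Complex x y0) - h (Complex x y1)) +
  'i%C * cint y0 y1 (fun y => h (Complex x1 y) - h (Complex x0 y)).

Definition bdcont h x0 x1 y0 y1 :=
  [/\ hcont h y0 x0 x1, hcont h y1 x0 x1, vcont h x0 y0 y1 & vcont h x1 y0 y1].

Lemma rectint_bound h x0 x1 y0 y1 M : x0 <= x1 -> y0 <= y1 ->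
  bdcont h x0 x1 y0 y1 ->
  (forall x y, x0 <= x <= x1 -> y0 <= y <= y1 ->
     [\/ x = x0, x = x1, y = y0 | y = y1] -> cmod (h (Complex x y)) <= M) ->
  cmod (rectint h x0 x1 y0 y1) <= 4 * M * ((x1 - x0) + (y1 - y0)).
Proof.
move=> x01 y01 [h0 h1 v0 v1] hM.
apply: le_trans (cmodD _ _) _; rewrite cmodM cmod_i mul1r.
have Hx : cmod (cint x0 x1 (fun x => h (Complex x y0) - h (Complex x y1)))
    <= 2 * (2 * M) * (x1 - x0).
  apply: cint_bound => // [|t tx]; first by apply: ccont_onB; exact: hcontP.
  apply: le_trans (cmodD _ _) _; rewrite cmod_opp.
  have := hM t y0 tx; rewrite lexx y01 => /(_ isT (Or43 _ _ _ erefl)).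
  have := hM t y1 tx; rewrite lexx y01 => /(_ isT (Or44 _ _ _ erefl)).
  lra.
have Hy : cmod (cint y0 y1 (fun y => h (Complex x1 y) - h (Complex x0 y)))
    <= 2 * (2 * M) * (y1 - y0).
  apply: cint_bound => // [|t ty]; first by apply: ccont_onB; exact: vcontP.
  apply: le_trans (cmodD _ _) _; rewrite cmod_opp.
  have := hM x0 t; rewrite lexx x01 => /(_ isT ty (Or41 _ _ _ erefl)).
  have := hM x1 t; rewrite lexx x01 => /(_ isT ty (Or42 _ _ _ erefl)).
  lra.
lra.
Qed.

(** The cut at [x1] is a side of both parts, run through in opposite directions, so its two
    contributions cancel. *)
Lemma rectint_splitx h x0 x1 x2 y0 y1 : x0 <= x1 -> x1 <= x2 ->
  bdcont h x0 x2 y0 y1 -> vcont h x1 y0 y1 ->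
  rectint h x0 x2 y0 y1 = rectint h x0 x1 y0 y1 + rectint h x1 x2 y0 y1.
Proof.
move=> x01 x12 [h0 h1 v0 v2] v1; rewrite /rectint.
rewrite (cint_split x01 x12); last by apply: ccont_onB; exact: hcontP.
have -> : (fun y => h (Complex x2 y) - h (Complex x0 y)) =
  (fun y => (h (Complex x1 y) - h (Complex x0 y)) +
            (h (Complex x2 y) - h (Complex x1 y))).
  by apply/funext => y; ring.
rewrite [X in _ + 'i%C * X = _]cintD; [by rewrite mulrDr addrACA|apply: ccont_onB; exact: vcontP..].
Qed.

Lemma rectint_splity h x0 x1 y0 y1 y2 : y0 <= y1 -> y1 <= y2 ->
  bdcont h x0 x1 y0 y2 -> hcont h y1 x0 x1 ->
  rectint h x0 x1 y0 y2 = rectint h x0 x1 y0 y1 + rectint h x0 x1 y1 y2.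
Proof.
move=> y01 y12 [h0 h2 v0 v1] h1; rewrite /rectint.
rewrite (cint_split y01 y12); last by apply: ccont_onB; exact: vcontP.
have -> : (fun x => h (Complex x y0) - h (Complex x y2)) =
  (fun x => (h (Complex x y0) - h (Complex x y1)) +
            (h (Complex x y1) - h (Complex x y2))).
  by apply/funext => y; ring.
rewrite [X in X + _ = _]cintD; [by rewrite mulrDr addrACA|apply: ccont_onB; exact: hcontP..].
Qed.

Lemma rectintD f g x0 x1 y0 y1 : bdcont f x0 x1 y0 y1 -> bdcont g x0 x1 y0 y1 ->
  rectint (fun z => f z + g z) x0 x1 y0 y1 =
  rectint f x0 x1 y0 y1 + rectint g x0 x1 y0 y1.
Proof.
move=> [h0 h1 v0 v1] [h0' h1' v0' v1']; rewrite /rectint.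
have -> : (fun x => f (Complex x y0) + g (Complex x y0) -
                    (f (Complex x y1) + g (Complex x y1))) =
  (fun x => (f (Complex x y0) - f (Complex x y1)) +
            (g (Complex x y0) - g (Complex x y1))).
  by apply/funext => y; ring.
have -> : (fun y => f (Complex x1 y) + g (Complex x1 y) -
                    (f (Complex x0 y) + g (Complex x0 y))) =
  (fun y => (f (Complex x1 y) - f (Complex x0 y)) +
            (g (Complex x1 y) - g (Complex x0 y))).
  by apply/funext => y; ring.
rewrite [X in X + _ = _]cintD; first rewrite [X in _ + 'i%C * X = _]cintD;
  first by rewrite mulrDr addrACA.
all: by apply: ccont_onB; (exact: hcontP || exact: vcontP).
Qed.

(** The horizontal pair of sides contributes -i l times the area, the vertical pair +i l times the
    area. *)
Lemma rectint_affine (k l : R[i]) x0 x1 y0 y1 : x0 <= x1 -> y0 <= y1 ->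
  rectint (fun z => k + l * z) x0 x1 y0 y1 = 0.
Proof.
move=> x01 y01; rewrite /rectint.
have gen (u v p q : R[i]) : k + l * (u + v * p) - (k + l * (u + v * q)) =
  l * v * (p - q) by ring.
have gen' (u v p q : R[i]) : k + l * (p + u * v) - (k + l * (q + u * v)) =
  l * (p - q) by ring.
have -> : (fun x => k + l * Complex x y0 - (k + l * Complex x y1)) =
  (fun=> l * 'i%C * (y0 - y1)%:C%C).
  by apply/funext => x; rewrite (complexRI x y0) (complexRI x y1) gen realcB.
have -> : (fun y => k + l * Complex x1 y - (k + l * Complex x0 y)) =
  (fun=> l * (x1 - x0)%:C%C).
  by apply/funext => y; rewrite (complexRI x1 y) (complexRI x0 y) gen' realcB.
have gen2 (u a b c d : R[i]) :
  l * u * (c - d) * (b - a) + u * (l * (b - a) * (d - c)) = 0 by ring.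
rewrite (cint_cst _ x01) (cint_cst _ y01) !realcB; exact: gen2.
Qed.

Definition derivable_on_rect h x0 x1 y0 y1 := forall x y,
  x0 <= x <= x1 -> y0 <= y <= y1 -> exists l, cderiv h (Complex x y) l.

Lemma derivable_bdcont h x0 x1 y0 y1 : x0 <= x1 -> y0 <= y1 ->
  derivable_on_rect h x0 x1 y0 y1 -> bdcont h x0 x1 y0 y1.
Proof.
move=> x01 y01 H.
have K x y : x0 <= x <= x1 -> y0 <= y <= y1 -> ccont h (Complex x y).
  by move=> hx hy; have [l /cderiv_ccont] := H x y hx hy.
by split=> t ht; apply: K => //; rewrite lexx ?x01 ?y01.
Qed.

Definition rect_half h (q r : R * R * R * R) :=
  let: (x0, x1, y0, y1) := q in let: (x0', x1', y0', y1') := r in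
  [/\ x0 <= x0' /\ x1' <= x1, y0 <= y0' /\ y1' <= y1,
      x1' - x0' = (x1 - x0) / 2, y1' - y0' = (y1 - y0) / 2 &
      cmod (rectint h x0 x1 y0 y1) <= 4 * cmod (rectint h x0' x1' y0' y1')].

(** The integral is the sum of those over the four quarters, so one quarter carries at least a
    fourth of its modulus. *)
Lemma rect_half_ex h x0 x1 y0 y1 : x0 <= x1 -> y0 <= y1 ->
  derivable_on_rect h x0 x1 y0 y1 -> exists r, rect_half h (x0, x1, y0, y1) r.
Proof.
move=> x01 y01 H.
pose xm := (x0 + x1) / 2; pose ym := (y0 + y1) / 2.
have x0m : x0 <= xm by rewrite /xm; lra.
have xm1 : xm <= x1 by rewrite /xm; lra.
have y0m : y0 <= ym by rewrite /ym; lra.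
have ym1 : ym <= y1 by rewrite /ym; lra.
have S a b c e : x0 <= a -> b <= x1 -> y0 <= c -> e <= y1 ->
    a <= b -> c <= e -> bdcont h a b c e.
  move=> ha hb hc he ab ce; apply: derivable_bdcont => // x y /andP[h1 h2] /andP[h3 h4].
  by apply: H; apply/andP; split; lra.
have E : rectint h x0 x1 y0 y1 =
  (rectint h x0 xm y0 ym + rectint h x0 xm ym y1) +
  (rectint h xm x1 y0 ym + rectint h xm x1 ym y1).
  rewrite (@rectint_splitx h x0 xm x1) //; last 2 first.
    by apply: S.
    by have [] := @S x0 xm y0 y1 ltac:(done) ltac:(done) ltac:(done) ltac:(done) x0m y01.
  rewrite (@rectint_splity h x0 xm y0 ym y1) //; last 2 first.
    by apply: S.
    by have [] := @S x0 xm y0 ym ltac:(done) ltac:(done) ltac:(done) ltac:(done) x0m y0m.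
  rewrite (@rectint_splity h xm x1 y0 ym y1) //.
    by apply: S.
  by have [] := @S xm x1 y0 ym ltac:(done) ltac:(done) ltac:(done) ltac:(done) xm1 y0m.
have T : cmod (rectint h x0 x1 y0 y1) <=
  cmod (rectint h x0 xm y0 ym) + cmod (rectint h x0 xm ym y1) +
  (cmod (rectint h xm x1 y0 ym) + cmod (rectint h xm x1 ym y1)).
  rewrite E; apply: le_trans (cmodD _ _) _.
  by apply: lerD; exact: cmodD.
set I := cmod (rectint h x0 x1 y0 y1) in T *.
have [l1|l1] := leP I (4 * cmod (rectint h x0 xm y0 ym)).
  by exists (x0, xm, y0, ym); split => //; rewrite /xm /ym; field.
have [l2|l2] := leP I (4 * cmod (rectint h x0 xm ym y1)).
  by exists (x0, xm, ym, y1); split => //; rewrite /xm /ym; field.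
have [l3|l3] := leP I (4 * cmod (rectint h xm x1 y0 ym)).
  by exists (xm, x1, y0, ym); split => //; rewrite /xm /ym; field.
have [l4|l4] := leP I (4 * cmod (rectint h xm x1 ym y1)).
  by exists (xm, x1, ym, y1); split => //; rewrite /xm /ym; field.
lra.
Qed.

Lemma nested_sup (u v : nat -> R) : (forall n, u n <= u n.+1) ->
  (forall n, v n.+1 <= v n) -> (forall n, u n <= v n) ->
  exists p, forall n, u n <= p <= v n.
Proof.
move=> hu hv uv.
have mu m n : (m <= n)%N -> u m <= u n.
  by move=> /subnK <-; elim: (n - m)%N => // k IH; rewrite addSn (le_trans IH).
have mv m n : (m <= n)%N -> v n <= v m.
  by move=> /subnK <-; elim: (n - m)%N => // k IH; rewrite addSn (le_trans _ IH).
have muv m n : u m <= v n.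
  have [mn|/ltnW nm] := leqP m n; first exact: le_trans (mu _ _ mn) (uv n).
  exact: le_trans (uv m) (mv _ _ nm).
exists (sup (range u)) => n; apply/andP; split.
  by apply: ub_le_sup; [exists (v 0%N) => _ [k _ <-]|exists n].
by apply: ge_sup; [exists (u 0%N), 0%N|move=> _ [k _ <-]].
Qed.

Lemma goursat h x0 x1 y0 y1 : x0 <= x1 -> y0 <= y1 ->
  derivable_on_rect h x0 x1 y0 y1 -> rectint h x0 x1 y0 y1 = 0.
Proof.
move=> x01 y01 H.
pose ok (q : R * R * R * R) := let: (a, b, c, d) := q in
  [/\ x0 <= a /\ b <= x1, a <= b, y0 <= c /\ d <= y1 & c <= d].
(* Tuples that are not subrectangles get an arbitrary successor, so that choice gives a total
   function to iterate. *)
have /choice [step hstep] : forall q, exists r, ok q -> ok r /\ rect_half h q r.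
  move=> q; have [qok|] := pselect (ok q); last by exists q.
  move: q qok => [[[a b] c] d] /= [[xa bx] ab [yc dy] cd].
  have H' : derivable_on_rect h a b c d.
    move=> x y /andP[h1 h2] /andP[h3 h4].
    by apply: H; apply/andP; split; lra.
  have [[[[a' b'] c'] d'] K] := rect_half_ex ab cd H'.
  exists (a', b', c', d') => _; split => //.
  by case: K => -[k1 k2] [k3 k4] k5 k6 k7; split; try split; lra.
pose q n := iter n step (x0, x1, y0, y1).
have okq n : ok (q n).
  elim: n => [|n IH]; first by split => //; split.
  by have [] := hstep _ IH.
have hq n : rect_half h (q n) (q n.+1) by have [] := hstep _ (okq n).
pose X0 n := (q n).1.1.1; pose X1 n := (q n).1.1.2.
pose Y0 n := (q n).1.2; pose Y1 n := (q n).2.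
have qE n : q n = (X0 n, X1 n, Y0 n, Y1 n).
  by rewrite /X0 /X1 /Y0 /Y1; case: (q n) => [[[]]].
have ok' n : [/\ x0 <= X0 n /\ X1 n <= x1, X0 n <= X1 n,
                 y0 <= Y0 n /\ Y1 n <= y1 & Y0 n <= Y1 n].
  by have := okq n; rewrite qE.
have hq' n : [/\ X0 n <= X0 n.+1 /\ X1 n.+1 <= X1 n,
   Y0 n <= Y0 n.+1 /\ Y1 n.+1 <= Y1 n,
   X1 n.+1 - X0 n.+1 = (X1 n - X0 n) / 2,
   Y1 n.+1 - Y0 n.+1 = (Y1 n - Y0 n) / 2 &
   cmod (rectint h (X0 n) (X1 n) (Y0 n) (Y1 n)) <=
     4 * cmod (rectint h (X0 n.+1) (X1 n.+1) (Y0 n.+1) (Y1 n.+1))].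
  by have := hq n; rewrite !qE.
have [p hp] : exists p, forall n, X0 n <= p <= X1 n.
  by apply: nested_sup => n; [have [[]] := hq' n|have [[]] := hq' n|have [] := ok' n].
have [r hr] : exists p, forall n, Y0 n <= p <= Y1 n.
  by apply: nested_sup => n; [have [_ []] := hq' n|have [_ []] := hq' n|have [] := ok' n].
set I := cmod (rectint h x0 x1 y0 y1).
pose s := (x1 - x0) + (y1 - y0).
have s0 : 0 <= s by rewrite /s; lra.
have size n : ((X1 n - X0 n) + (Y1 n - Y0 n)) * 2 ^+ n = s.
  elim: n => [|n IH]; first by rewrite expr0 mulr1.
  by have [_ _ -> -> _] := hq' n; rewrite -[RHS]IH exprS; field.
have big n : I <= 4 ^+ n * cmod (rectint h (X0 n) (X1 n) (Y0 n) (Y1 n)).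
  elim: n => [|n IH]; first by rewrite expr0 mul1r.
  apply: le_trans IH _; rewrite exprSr -mulrA ler_wpM2l ?exprn_ge0 //.
  by have [] := hq' n.
have [l hl] : exists l, cderiv h (Complex p r) l.
  by apply: H; [exact: (hp 0%N)|exact: (hr 0%N)].
have small e : 0 < e -> I <= 4 * e * s ^+ 2.
  move=> e0; have [d d0 hd] := hl e e0.
  have [n nd] : exists n, s < d * 2 ^+ n.
    pose n := Num.bound (s / d); exists n.
    have : s / d < n%:R by apply: archi_boundP; rewrite divr_ge0 // ltW.
    rewrite ltr_pdivrMr // => /lt_le_trans; apply.
    have n2 : n%:R <= 2 ^+ n :> R by rewrite -natrX ler_nat ltnW // ltn_expl.
    by rewrite mulrC ler_wpM2l // ltW.
  have [[c1 c2] c3 [c4 c5] c6] := ok' n.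
  have sn := size n.
  set sx := X1 n - X0 n in sn; set sy := Y1 n - Y0 n in sn.
  have sx0 : 0 <= sx by rewrite /sx; lra.
  have sy0 : 0 <= sy by rewrite /sy; lra.
  have P0 : 0 < 2 ^+ n :> R by rewrite exprn_gt0.
  have sd : sx + sy < d by move: nd; rewrite -sn; nra.
  have K x y : X0 n <= x <= X1 n -> Y0 n <= y <= Y1 n ->
      cmod (Complex x y - Complex p r) <= sx + sy.
    move=> /andP[k1 k2] /andP[k3 k4].
    have /andP[k5 k6] := hp n; have /andP[k7 k8] := hr n.
    rewrite complexB.
    apply: le_trans (cmod_Complex_le _ _) _.
    apply: lerD; rewrite ler_norml; apply/andP; split; rewrite /sx /sy; lra.
  (* A is the tangent map of h at the common point of the nested rectangles; its integral vanishes,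
     which leaves that of the remainder B. *)
  pose A z := (h (Complex p r) - l * Complex p r) + l * z.
  pose B z := h z - A z.
  have hAB : h = (fun z => A z + B z).
    by apply/funext => z; rewrite /B; ring.
  have dA z : cderiv A z l.
    apply: cderiv_eq (cderivD (cderivC _ _) (cderivM (cderivC l _) (cderivId _))).
    ring.
  have bA : bdcont A (X0 n) (X1 n) (Y0 n) (Y1 n).
    by apply: derivable_bdcont => // x y _ _; exists l.
  have bB : bdcont B (X0 n) (X1 n) (Y0 n) (Y1 n).
    apply: derivable_bdcont => // x y /andP[k1 k2] /andP[k3 k4].
    have [m hm] : exists m, cderiv h (Complex x y) m.
      by apply: H; apply/andP; split; lra.
    by exists (m - l); apply: cderivD => //; exact: cderivN.
  have EI : rectint h (X0 n) (X1 n) (Y0 n) (Y1 n) =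
            rectint B (X0 n) (X1 n) (Y0 n) (Y1 n).
    by rewrite {1}hAB rectintD // /A rectint_affine // add0r.
  have LB : cmod (rectint B (X0 n) (X1 n) (Y0 n) (Y1 n)) <=
            4 * (e * (sx + sy)) * (sx + sy).
    apply: rectint_bound => // x y hx hy _.
    have kk := K x y hx hy.
    have := hd _ (le_lt_trans kk sd).
    have -> : h (Complex x y) - h (Complex p r) - l * (Complex x y - Complex p r)
      = B (Complex x y) by rewrite /B /A; ring.
    by move/le_trans; apply; rewrite ler_wpM2l // ltW.
  (* The factor 4 ^ n lost in the bisection cancels against the square of [sx + sy], which equals s
     / 2 ^ n. *)
  apply: le_trans (big n) _; rewrite EI.
  apply: le_trans (ler_wpM2l _ LB) _; first by rewrite exprn_ge0.
  rewrite -sn exprMn -exprM mulnC exprM (_ : 2 ^+ 2 = 4); last by ring.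
  by rewrite le_eqVlt; apply/orP; left; apply/eqP; ring.
apply/eqP; rewrite -cmod_eq0 eq_le cmod_ge0 andbT -/I.
apply/ler_addgt0Pl => e e0; rewrite addr0.
have S1 : 0 < 4 * (s ^+ 2 + 1) by rewrite mulr_gt0 // ltr_pwDr // sqr_ge0.
apply: le_trans (small _ (divr_gt0 e0 S1)) _.
have -> : 4 * (e / (4 * (s ^+ 2 + 1))) * s ^+ 2 = e * (s ^+ 2 / (s ^+ 2 + 1)).
  by field; have := sqr_ge0 s; lra.
apply: ler_piMr; first exact: ltW.
have := sqr_ge0 s => s20; rewrite ler_pdivrMr; lra.
Qed.

End Goursat.

(** * The Cauchy estimate *)

Section CauchyEstimate.
Variable R : realType.
Implicit Types (a b c M x y e t : R) (f g h : R[i] -> R[i]) (z w l : R[i]).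

Lemma complex_inv x y :
  (Complex x y)^-1 = Complex (x / (x ^+ 2 + y ^+ 2)) (- y / (x ^+ 2 + y ^+ 2)).
Proof. by rewrite mulNr. Qed.

Lemma cmod_ge_max x y a : a <= `|x| \/ a <= `|y| -> a <= cmod (Complex x y).
Proof.
by case=> h; apply: le_trans h _; [exact: (cmod_le_Re (Complex x y))|
  exact: (cmod_le_Im (Complex x y))].
Qed.

Lemma complex_neq0 x y : x != 0 \/ y != 0 -> Complex x y != 0.
Proof. by case=> h; rewrite eq_complex /= negb_and h ?orbT. Qed.

(** The integral is 2 pi i. For the lower bound 4, each pair of opposite sides contributes to the
    imaginary part the integral of 2 d / (x^2 + d^2), which is at least 1 / d on an interval of
    length 2 d. *)
Lemma rectint_inv_ge (d : R) : 0 < d ->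
  4 <= cmod (rectint (fun z => z^-1) (- d) d (- d) d).
Proof.
move=> d0.
have nz := complex_neq0.
have cj z : z != 0 -> ccont (fun w => w^-1) z.
  by move=> z0; apply: cderiv_ccont; exact: cderivV (cderivId _).
have ch y : y != 0 -> hcont (fun w => w^-1) y (- d) d.
  by move=> y0 x _; apply/cj/nz; right.
have cv y : y != 0 -> vcont (fun w => w^-1) y (- d) d.
  by move=> y0 x _; apply/cj/nz; left.
have dn : d != 0 by rewrite gt_eqF.
have dn' : - d != 0 by rewrite oppr_eq0.
have C1 : ccont_on (- d) d (fun x => (Complex x (- d))^-1 - (Complex x d)^-1).
  by apply: ccont_onB; apply: hcontP; apply: ch.
have C2 : ccont_on (- d) d (fun y => (Complex d y)^-1 - (Complex (- d) y)^-1).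
  by apply: ccont_onB; apply: vcontP; apply: cv.
have dd : - d <= d by lra.
have L x : - d <= x <= d -> d^-1 <= 2 * d / (x ^+ 2 + d ^+ 2).
  move=> /andP[h1 h2]; have x2 : x ^+ 2 <= d ^+ 2 by nra.
  have D0 : 0 < x ^+ 2 + d ^+ 2 by rewrite ltr_wpDl ?sqr_ge0 // exprn_gt0.
  rewrite ler_pdivlMr // mulrC ler_pdivrMr // (_ : 2 * d * d = d ^+ 2 + d ^+ 2).
    by rewrite lerD2r.
  by ring.
have L1 : 2 <= int1 (- d) d
    (fun x => complex.Im ((Complex x (- d))^-1 - (Complex x d)^-1)).
  have -> : 2 = d^-1 * (d - - d) by field.
  rewrite -int1_cst //; apply: le_int1 => [||x hx].
  - exact: cont_on_cst.
  - exact: ccont_on_Im C1.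
  - rewrite !complex_inv /=; apply: le_trans (L x hx) _.
    rewrite le_eqVlt; apply/orP; left; apply/eqP.
    by rewrite sqrrN; ring.
have L2 : 2 <= int1 (- d) d
    (fun y => complex.Re ((Complex d y)^-1 - (Complex (- d) y)^-1)).
  have -> : 2 = d^-1 * (d - - d) by field.
  rewrite -int1_cst //; apply: le_int1 => [||x hx].
  - exact: cont_on_cst.
  - exact: ccont_on_Re C2.
  - rewrite !complex_inv /=; apply: le_trans (L x hx) _.
    rewrite le_eqVlt; apply/orP; left; apply/eqP.
    by rewrite sqrrN (addrC (d ^+ 2)); ring.
apply: le_trans (cmod_le_Im _); rewrite ger0_norm.
  by rewrite /rectint /cint; simpc => /=; lra.
by rewrite /rectint /cint; simpc => /=; lra.
Qed.

Lemma cmod_lt3 x y : -1 <= x <= 1 -> -1 <= y <= 1 -> cmod (Complex x y) < 3.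
Proof.
move=> hx hy; apply: le_lt_trans (cmod_Complex_le _ _) _.
have x1 : `|x| <= 1 by rewrite ler_norml.
have y1 : `|y| <= 1 by rewrite ler_norml.
lra.
Qed.

Section Punctured.
Variable k : R[i] -> R[i].
Hypothesis dk : forall z, z != 0 -> cmod z < 3 -> exists l, cderiv k z l.

Lemma punctured_ccont x y : -1 <= x <= 1 -> -1 <= y <= 1 -> x != 0 \/ y != 0 ->
  ccont k (Complex x y).
Proof.
move=> hx hy /complex_neq0 z0.
by have [l /cderiv_ccont] := dk z0 (cmod_lt3 hx hy).
Qed.

Lemma punctured_hcont y a b : -1 <= a -> b <= 1 -> -1 <= y <= 1 -> y != 0 ->
  hcont k y a b.
Proof.
move=> ha hb hy y0 x /andP[xa xb]; apply: punctured_ccont hy _; last by right.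
by rewrite (le_trans ha) // (le_trans xb).
Qed.

Lemma punctured_vcont x a b : -1 <= a -> b <= 1 -> -1 <= x <= 1 -> x != 0 ->
  vcont k x a b.
Proof.
move=> ha hb hx x0 y /andP[ya yb]; apply: punctured_ccont hx _ _; last by left.
by rewrite (le_trans ha) // (le_trans yb).
Qed.

Lemma punctured_bdcont x0 x1 y0 y1 : -1 <= x0 <= 1 -> -1 <= x1 <= 1 ->
  -1 <= y0 <= 1 -> -1 <= y1 <= 1 ->
  x0 != 0 -> x1 != 0 -> y0 != 0 -> y1 != 0 -> bdcont k x0 x1 y0 y1.
Proof.
move=> hx0 hx1 hy0 hy1 *.
have [/andP[? ?] /andP[? ?]] := (hx0, hx1).
have [/andP[? ?] /andP[? ?]] := (hy0, hy1).
by split; [exact: punctured_hcont|exact: punctured_hcont|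
           exact: punctured_vcont|exact: punctured_vcont].
Qed.

Lemma punctured_rectint0 x0 x1 y0 y1 : -1 <= x0 -> x1 <= 1 -> -1 <= y0 -> y1 <= 1 ->
  x0 <= x1 -> y0 <= y1 -> [\/ 0 < x0, x1 < 0, 0 < y0 | y1 < 0] ->
  rectint k x0 x1 y0 y1 = 0.
Proof.
move=> h1 h2 h3 h4 h5 h6 h7; apply: goursat => // x y /andP[a1 a2] /andP[a3 a4].
apply: dk; last first.
  by apply: cmod_lt3; rewrite ?(le_trans h1 a1) ?(le_trans a2 h2)
    ?(le_trans h3 a3) ?(le_trans a4 h4).
apply: complex_neq0; case: h7 => h.
- by left; rewrite gt_eqF // (lt_le_trans h).
- by left; rewrite lt_eqF // (le_lt_trans _ h).
- by right; rewrite gt_eqF // (lt_le_trans h).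
- by right; rewrite lt_eqF // (le_lt_trans _ h).
Qed.

(** The frame between the two squares is cut into four rectangles that avoid 0: full-height strips
    on the left and right, then the pieces below and above the small square. *)
Lemma punctured_rectint t : 0 < t -> t <= 1 / 2 ->
  rectint k (-1) 1 (-1) 1 = rectint k (- t) t (- t) t.
Proof.
move=> t0 t1.
have tn : t != 0 by rewrite gt_eqF.
have tn' : - t != 0 by rewrite oppr_eq0.
have n1 := oner_neq0 R.
have n1' : -1 != 0 :> R by rewrite oppr_eq0.
have b1 : (- 1 <= 1 :> R) && (1 <= 1 :> R) by rewrite lexx andbT; lra.
have b2 : (- 1 <= - 1 :> R) && (- 1 <= 1 :> R) by rewrite lexx /=; lra.
have b3 : -1 <= t <= 1 by lra.
have b4 : -1 <= - t <= 1 by lra.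
have c1 : -1 <= - t by lra.
have c2 : - t <= 1 by lra.
have c3 : - t <= t by lra.
have c4 : t <= 1 by lra.
have bq := punctured_bdcont.
rewrite (@rectint_splitx _ k (-1) (- t) 1) //; last 2 first.
- exact: bq.
- by apply: punctured_vcont.
rewrite (@rectint_splitx _ k (- t) t 1) //; last 2 first.
- exact: bq.
- by apply: punctured_vcont.
rewrite (@rectint_splity _ k (- t) t (-1) (- t) 1) //; last 2 first.
- exact: bq.
- by apply: punctured_hcont.
rewrite (@rectint_splity _ k (- t) t (- t) t 1) //; last 2 first.
- exact: bq.
- by apply: punctured_hcont.
have c5 : - t < 0 by lra.
have c6 : (-1 : R) <= 1 by lra.
have i1 : rectint k (-1) (- t) (-1) 1 = 0.
  by apply: punctured_rectint0 => //; exact: Or42.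
have i2 : rectint k t 1 (-1) 1 = 0.
  by apply: punctured_rectint0 => //; [lra|exact: Or41].
have i3 : rectint k (- t) t (-1) (- t) = 0.
  by apply: punctured_rectint0 => //; exact: Or44.
have i4 : rectint k (- t) t t 1 = 0.
  by apply: punctured_rectint0 => //; [lra|exact: Or43].
by rewrite i1 i2 i3 i4 !add0r !addr0.
Qed.

End Punctured.

(** The integral of 1 / z over the small square is that of k over the large one minus that of r. On
    the small boundary |r| is at most e / t while the side lengths are 2 t, so the bound 16 e for r
    is independent of t. *)
Lemma punctured_rectint_bound k r e t M :
  (forall z, z != 0 -> cmod z < 3 -> exists l, cderiv k z l) ->
  (forall z, z != 0 -> cmod z < 3 -> exists l, cderiv r z l) ->
  (forall z, k z = z^-1 + r z) -> 0 < t -> t <= 1 / 2 -> 0 <= e ->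
  (forall z, 1 <= cmod z -> cmod z < 3 -> cmod (k z) <= M) ->
  (forall z, z != 0 -> cmod z < 3 * t -> cmod (r z) <= e / cmod z) ->
  4 <= 16 * M + 16 * e.
Proof.
move=> dk dr kr t0 t1 e0 kM re.
have tn : t != 0 by rewrite gt_eqF.
have tn' : - t != 0 by rewrite oppr_eq0.
have n1 := oner_neq0 R.
have n1' : -1 != 0 :> R by rewrite oppr_eq0.
have b1 : (- 1 <= 1 :> R) && (1 <= 1 :> R) by rewrite lexx andbT; lra.
have b2 : (- 1 <= - 1 :> R) && (- 1 <= 1 :> R) by rewrite lexx /=; lra.
have b3 : -1 <= t <= 1 by lra.
have b4 : -1 <= - t <= 1 by lra.
have Bk : cmod (rectint k (-1) 1 (-1) 1) <= 4 * M * ((1 - -1) + (1 - -1)).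
  apply: rectint_bound; [lra|lra|exact: punctured_bdcont|].
  move=> x y hx hy bd; apply: kM; last exact: cmod_lt3.
  by apply: cmod_ge_max; case: bd => ->; [left|left|right|right];
    rewrite ?normrN normr1.
have Br : cmod (rectint r (- t) t (- t) t) <= 4 * (e / t) * ((t - - t) + (t - - t)).
  apply: rectint_bound; [lra|lra|exact: punctured_bdcont|].
  move=> x y hx hy bd.
  have zt : t <= cmod (Complex x y).
    by apply: cmod_ge_max; case: bd => ->; [left|left|right|right];
      rewrite ?normrN gtr0_norm.
  have z0 : 0 < cmod (Complex x y) := lt_le_trans t0 zt.
  apply: le_trans (re _ _ _) _; first by rewrite -cmod_gt0.
    apply: le_lt_trans (cmod_Complex_le _ _) _.
    have x1 : `|x| <= t by rewrite ler_norml.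
    have y1 : `|y| <= t by rewrite ler_norml.
    lra.
  by rewrite ler_wpM2l // lef_pV2.
have dj z : z != 0 -> cmod z < 3 -> exists l, cderiv (fun w => w^-1) z l.
  by move=> z0 _; exists (- z ^- 2 * 1); exact: cderivV (cderivId _).
have J4 := rectint_inv_ge t0.
have EJ : rectint k (- t) t (- t) t =
    rectint (fun z => z^-1) (- t) t (- t) t + rectint r (- t) t (- t) t.
  rewrite -rectintD; [|exact: punctured_bdcont|exact: punctured_bdcont].
  by have -> : k = (fun z => z^-1 + r z) by apply/funext.
have EJ' : rectint (fun z => z^-1) (- t) t (- t) t =
  rectint k (-1) 1 (-1) 1 - rectint r (- t) t (- t) t.
  by rewrite (punctured_rectint dk t0 t1) EJ addrK.
rewrite EJ' in J4; apply: le_trans J4 _.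
apply: le_trans (cmodD _ _) _; rewrite cmod_opp.
have T : 4 * (e / t) * (t - - t + (t - - t)) = 16 * e by field.
rewrite T in Br; clear -Bk Br; lra.
Qed.

(* f is compared with the identity through k z = (f z - f 0) / z^2, whose
   integral along the boundary of a square about 0 does not depend on the square,
   while that of 1 / z is bounded below. *)
Lemma cauchy_estimate_unit f M :
  (forall z, cmod z < 3 -> exists l, cderiv f z l) ->
  (forall z, cmod z < 3 -> cmod (f z) <= M) ->
  cderiv f 0 1 -> 1 <= 8 * M.
Proof.
move=> df fM f1.
have f0M : cmod (f 0) <= M by apply: fM; rewrite cmod0.
suff H e : 0 < e -> 4 <= 16 * (2 * M) + 16 * e.
  rewrite leNgt; apply/negP => h.
  have := H ((1 - 8 * M) / 16) ltac:(lra); lra.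
move=> e0; have [d d0 hd] := f1 e e0.
have [k kE] : exists k : R[i] -> R[i], forall z, k z = (f z - f 0) * (z ^+ 2)^-1.
  by eexists.
have [r rE] : exists r : R[i] -> R[i], forall z, r z = k z - z^-1.
  by eexists.
have dk z : z != 0 -> cmod z < 3 -> exists l, cderiv k z l.
  move=> z0 /df [l hl]; rewrite (funext kE); eexists.
  apply: cderivM; first exact: cderivD hl (cderivC _ _).
  apply: cderivV; first by rewrite expf_neq0.
  under eq_fun do rewrite expr2.
  exact: (cderivM (cderivId _) (cderivId _)).
have dr z : z != 0 -> cmod z < 3 -> exists l, cderiv r z l.
  move=> z0 /(dk _ z0) [l hl]; rewrite (funext rE); eexists.
  by apply: cderivD hl _; apply: cderivN; exact: cderivV (cderivId _).
(* The remainder is estimated for |z| < 3 t, which lies in the disc of radius d where the linear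
   approximation of f holds. *)
have [t [t0 t1 td]] : exists t : R, [/\ 0 < t, t <= 1 / 2 & t <= d / 3].
  exists (Num.min (1 / 2) (d / 3)); rewrite lt_min !ge_min !lexx orbT.
  by split => //; apply/andP; split; lra.
apply: (@punctured_rectint_bound k r e t) => //; last 3 first.
- exact: ltW.
- move=> z z1 z3; rewrite kE cmodM cmodV cmodX.
  apply: (@le_trans _ _ (cmod (f z - f 0))).
    apply: ler_piMr; first exact: cmod_ge0.
    by rewrite invf_le1 ?exprn_ege1 // exprn_gt0 // (lt_le_trans ltr01).
  apply: le_trans (cmodD _ _) _; rewrite cmod_opp.
  have := fM _ z3; clear -f0M; lra.
- move=> z zn zt.
  have z0 : 0 < cmod z by rewrite cmod_gt0.
  have zd : cmod (z - 0) < d by rewrite subr0; clear -td zt; lra.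
  have := hd _ zd; rewrite !subr0 mul1r.
  have -> : r z = (f z - f 0 - z) * (z ^+ 2)^-1.
    by rewrite rE kE; field; exact: zn.
  move=> hz; rewrite cmodM cmodV cmodX ler_pdivrMr ?exprn_gt0 //.
  by apply: le_trans hz _; rewrite expr2 mulrA divfK // gt_eqF.
- by move=> z; rewrite rE addrC subrK.
Qed.

(** The disc of radius r is rescaled to radius 3 and f is divided by l r / 3, which makes the
    derivative 1; this turns the 8 of [cauchy_estimate_unit] into 24 = 3 * 8. There 8 = 32 / 4: the
    outer integral is at most 16 (2 M), against the lower bound 4 for that of 1 / z. *)
Lemma cauchy_estimate f (p : R[i]) (r M : R) l : 0 < r ->
  (forall z, cmod (z - p) < r -> exists l, cderiv f z l) ->
  (forall z, cmod (z - p) < r -> cmod (f z) <= M) ->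
  cderiv f p l -> cmod l <= 24 * M / r.
Proof.
move=> r0 df fM fl.
have M0 : 0 <= M.
  by apply: le_trans (fM p _); rewrite ?cmod_ge0 // subrr cmod0.
have [->|l0] := eqVneq l 0; first by rewrite cmod0; apply: divr_ge0; lra.
have r30 : 0 < r / 3 by lra.
have r3 : (r / 3)%:C%C != 0 :> R[i] by rewrite -cmod_gt0 cmod_real gtr0_norm.
pose k := (l * (r / 3)%:C%C)^-1.
have k0 : l * (r / 3)%:C%C != 0 by rewrite mulf_neq0.
pose A (w : R[i]) := p + (r / 3)%:C%C * w.
have dA w : cderiv A w (r / 3)%:C%C.
  apply: cderiv_eq (cderivD (cderivC _ _) (cderivM (cderivC _ _) (cderivId _))).
  ring.
have A0 : A 0 = p by rewrite /A; ring.
have Ad w : cmod w < 3 -> cmod (A w - p) < r.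
  move=> w3; have -> : A w - p = (r / 3)%:C%C * w by rewrite /A; ring.
  rewrite cmodM cmod_real gtr0_norm //.
  by rewrite mulrAC ltr_pdivrMr // ltr_pM2l.
have := @cauchy_estimate_unit (fun w => k * f (A w)) (cmod k * M).
have cl : 0 < cmod l by rewrite cmod_gt0.
have -> : 8 * (cmod k * M) = 24 * M / (cmod l * r).
  rewrite /k cmodV cmodM cmod_real gtr0_norm //.
  by field; lra.
move=> H; rewrite ler_pdivlMr //; have := H _ _ _.
rewrite ler_pdivlMr ?mulr_gt0 // mul1r; apply.
- move=> z /Ad /df [m hm]; eexists; apply: cderivM (cderivC _ _) _.
  exact: cderiv_comp hm (dA _).
- by move=> z /Ad /fM h; rewrite cmodM ler_wpM2l // cmod_ge0.
- have := cderiv_comp (f := f) (g := A) (z := 0) (l := l) (m := (r / 3)%:C%C).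
  rewrite A0 => /(_ fl (dA _)) h.
  apply: cderiv_eq (cderivM (cderivC k _) h).
  by rewrite mulr0 addr0 /k mulVf.
Qed.

End CauchyEstimate.

(** * Holomorphic functions on a disc *)

Section Holomorphic.
Variable R : realType.
Implicit Types (r M e d : R) (f g : R[i] -> R[i]) (z w l c : R[i]).
Implicit Types A U V : set R[i].

Lemma cderivE f z l : cderiv f z l -> derive1 f z = l.
Proof. by case/cderiv_derivable. Qed.

Lemma hol_cderiv A f z : holomorphic_on A f -> A z -> cderiv f z (derive1 f z).
Proof. by move=> hf /hf; exact: cderivP. Qed.

Lemma cderiv_hol A f : (forall z, A z -> exists l, cderiv f z l) -> holomorphic_on A f.
Proof. by move=> h z /h [l /cderiv_derivable[]]. Qed.

Lemma holS A B f : A `<=` B -> holomorphic_on B f -> holomorphic_on A f.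
Proof. by move=> AB hf z /AB /hf. Qed.

Lemma disc_center c r : 0 < r -> disc c r c.
Proof. by rewrite /disc /= subrr cmod0. Qed.

Lemma disc_sub c z r r' : cmod (z - c) + r' <= r -> disc z r' `<=` disc c r.
Proof.
move=> h w wz; apply: le_lt_trans (cmod_dist_trans z _ _) _.
by apply: lt_le_trans h; rewrite addrC ltrD2l.
Qed.

Lemma disc_subr c r r' : r' <= r -> disc c r' `<=` disc c r.
Proof. by move=> h; apply: disc_sub; rewrite subrr cmod0 add0r. Qed.

Lemma disc_open_nbhs c r : 0 < r -> forall z, disc c r z ->
  exists2 e : R, 0 < e & disc z e `<=` disc c r.
Proof.
move=> r0 z zc; exists (r - cmod (z - c)); first by rewrite subr_gt0.
by apply: disc_sub; rewrite addrC subrK.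
Qed.

(** Continuous induction along the segment proves the inequality with M + e in place of M: near a
    parameter t the linear approximation controls the increments on both sides. Then e tends to
    0. *)
Lemma mean_value f (p q : R[i]) M :
  (forall t : R, 0 <= t <= 1 -> exists2 l, cderiv f (p + t%:C%C * (q - p)) l & cmod l <= M) ->
  cmod (f q - f p) <= M * cmod (q - p).
Proof.
move=> H; set n := cmod (q - p); have n0 : 0 <= n := cmod_ge0 _.
pose g t := p + t%:C%C * (q - p).
have gB s t : g s - g t = (s - t)%:C%C * (q - p).
  by rewrite /g realcB; ring.
have g0 : g 0 = p by rewrite /g (_ : 0%:C%C = 0) // mul0r addr0.
have g1 : g 1 = q by rewrite /g (_ : 1%:C%C = 1) // mul1r addrC subrK.
have key e : 0 < e -> cmod (f q - f p) <= (M + e) * n.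
  move=> e0; have [->|] := eqVneq q p; first by rewrite subrr cmod0 mulr_ge0 // addr_ge0 ?(ltW e0) //;
    have [l _] := H 0 ltac:(rewrite lexx ler01 //); apply: le_trans (cmod_ge0 _).
  rewrite -subr_eq0 -cmod_gt0 -/n => n1.
  suff : cmod (f (g 1) - f p) <= (M + e) * (1 * n) by rewrite g1 mul1r.
  apply: (@unit_itv_induction _ (fun t => cmod (f (g t) - f p) <= (M + e) * (t * n))).
    by rewrite g0 subrr cmod0 mul0r mulr0.
  move=> t t01; have [l hl lM] := H t t01.
  have [d d0 hd] := hl e e0.
  exists (d / n); first exact: divr_gt0.
  move=> s s' s0 s1 ts st ts' s't Ps.
  have near u : t - d / n < u -> u < t + d / n ->
      cmod (f (g u) - f (g t)) <= (M + e) * (`|u - t| * n).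
    move=> u1 u2; have gu : cmod (g u - g t) = `|u - t| * n.
      by rewrite gB cmodM cmod_real.
    have ud : cmod (g u - g t) < d.
      by rewrite gu -ltr_pdivlMr // ltr_norml; lra.
    have -> : f (g u) - f (g t) =
      (f (g u) - f (g t) - l * (g u - g t)) + l * (g u - g t) by ring.
    apply: le_trans (cmodD _ _) _; rewrite cmodM -gu mulrDl [leRHS]addrC.
    by apply: lerD; [exact: hd|rewrite ler_wpM2r ?cmod_ge0].
  have dn : 0 < d / n by exact: divr_gt0.
  have k1 := near s ltac:(lra) ltac:(lra).
  have k2 := near s' ltac:(lra) ltac:(lra).
  rewrite ler0_norm in k1; last lra.
  rewrite ger0_norm in k2; last lra.
  have -> : f (g s') - f p = (f (g s') - f (g t)) + (f (g t) - f (g s)) + (f (g s) - f p)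
    by ring.
  apply: le_trans (cmodD _ _) _.
  apply: le_trans (lerD (cmodD _ _) Ps) _.
  rewrite (cmod_sub (f (g t))).
  apply: le_trans (lerD (lerD k2 k1) (lexx _)) _.
  by rewrite le_eqVlt; apply/orP; left; apply/eqP; ring.
apply/ler_addgt0Pl => e e0.
have n1 : 0 < n + 1 by lra.
apply: le_trans (key _ (divr_gt0 e0 n1)) _.
rewrite mulrDl addrC lerD2r -mulrA [_^-1 * n]mulrC.
by apply: ler_piMr; [exact: ltW|rewrite ler_pdivrMr // mul1r; lra].
Qed.

Lemma disc_convex c r (p q : R[i]) (t : R) : 0 <= t <= 1 ->
  disc c r p -> disc c r q -> disc c r (p + t%:C%C * (q - p)).
Proof.
move=> /andP[t0 t1] hp hq; rewrite /disc /=.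
have -> : p + t%:C%C * (q - p) - c = (1 - t)%:C%C * (p - c) + t%:C%C * (q - c).
  by rewrite realcB (_ : 1%:C%C = 1) //; ring.
apply: le_lt_trans (cmodD _ _) _; rewrite !cmodM !cmod_real.
rewrite !ger0_norm //; last lra.
move: hp hq; rewrite /disc /= => hp hq.
have [->|tn] := eqVneq t 0; first by rewrite subr0 mul1r mul0r addr0.
have tp : 0 < t by rewrite lt_def tn.
nra.
Qed.

Lemma mean_value_disc f c r M (p q : R[i]) : holomorphic_on (disc c r) f ->
  (forall z, disc c r z -> cmod (derive1 f z) <= M) ->
  disc c r p -> disc c r q -> cmod (f q - f p) <= M * cmod (q - p).
Proof.
move=> hf fM hp hq; apply: mean_value => t t01.
have dz := disc_convex t01 hp hq.
by exists (derive1 f (p + t%:C%C * (q - p))); [exact: hol_cderiv hf dz|exact: fM].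
Qed.

Lemma deriv_bound f c r r' M : 0 < r' -> r' < r -> holomorphic_on (disc c r) f ->
  (forall z, disc c r z -> cmod (f z) <= M) ->
  forall z, disc c r' z -> cmod (derive1 f z) <= 24 * M / (r - r').
Proof.
move=> r'0 rr hf fM z hz.
have S : disc z (r - r') `<=` disc c r.
  by apply: disc_sub; move: hz; rewrite /disc /=; lra.
have dz : disc c r z by apply: disc_subr hz; exact: ltW.
apply: (@cauchy_estimate _ f z) (hol_cderiv hf dz); first lra.
  by move=> w /S dw; exists (derive1 f w); exact: hol_cderiv hf dw.
by move=> w /S /fM.
Qed.

(** The Cauchy estimate is applied on the disc of radius r / 8 about z to the difference x |-> f (x
    + h) - f x with h = w - z. The mean value inequality on the disc of radius r / 2 bounds this
    difference by (48 M / r) |h|; |h| < r / 4 keeps all points in that disc. *)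
Lemma deriv_lipschitz f c r M : 0 < r -> holomorphic_on (disc c r) f ->
  (forall z, disc c r z -> cmod (f z) <= M) ->
  forall z w, disc c (r / 8) z -> disc c (r / 8) w ->
  cmod (derive1 f w - derive1 f z) <= 24 * 48 * 8 * M / r ^+ 2 * cmod (w - z).
Proof.
move=> r0 hf fM z w hz hw.
have r20 : 0 < r / 2 by lra.
have r2 : r / 2 < r by lra.
have fb := deriv_bound r20 r2 hf fM.
have hf2 : holomorphic_on (disc c (r / 2)) f.
  by apply: holS hf; apply: disc_subr; lra.
pose h := w - z; pose g x := f (x + h) - f x.
have hh : cmod h < r / 4.
  by have := cmod_dist_trans c w z; rewrite (cmod_sub c); move: hz hw; rewrite /disc /= /h; lra.
have inz x : disc z (r / 8) x -> disc c (r / 2) x.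
  by apply: disc_sub; move: hz; rewrite /disc /=; lra.
have inw x : disc z (r / 8) x -> disc c (r / 2) (x + h).
  move=> hx; have := cmodD (x - c) h.
  have -> : x - c + h = x + h - c by ring.
  have := cmod_dist_trans z x c.
  by move: hz hx; rewrite /disc /=; lra.
have hg x : disc z (r / 8) x -> cderiv g x (derive1 f (x + h) - derive1 f x).
  move=> hx; apply: cderivD; last first.
    by apply: cderivN; exact: hol_cderiv hf2 (inz _ hx).
  rewrite -[derive1 f (x + h)]mulr1.
  apply: (@cderiv_comp _ f (fun y => y + h)); first exact: hol_cderiv hf2 (inw _ hx).
  by apply: cderiv_eq (cderivD (cderivId _) (cderivC _ _)); rewrite addr0.
have zz : disc z (r / 8) z by apply: disc_center; lra.
have r80 : 0 < r / 8 by lra.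
have := @cauchy_estimate _ g z (r / 8) (24 * M / (r - r / 2) * cmod h) _ r80 _ _ (hg z zz).
have -> : z + h = w by rewrite /h; ring.
have -> : 24 * (24 * M / (r - r / 2) * cmod h) / (r / 8) = 24 * 48 * 8 * M / r ^+ 2 * cmod h.
  by field; lra.
apply.
- by move=> x hx; eexists; exact: hg.
- move=> x hx; have := mean_value_disc hf2 fb (inz _ hx) (inw _ hx).
  by rewrite (_ : x + h - x = h) //; ring.
Qed.

(** A Cauchy criterion with explicit error: all intervals [u s - v s, u s + v s] meet pairwise,
    hence they have a common point, the supremum of their left ends. *)
Lemma real_limit (T : Type) (P : set T) (u v : T -> R) : P !=set0 ->
  (forall s t, P s -> P t -> `|u s - u t| <= v s + v t) ->
  exists L, forall s, P s -> `|u s - L| <= v s.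
Proof.
move=> [t0 Pt0] H; pose S := [set u s - v s | s in P].
have ubS t : P t -> ubound S (u t + v t).
  by move=> Pt _ [s Ps <-]; have := H _ _ Ps Pt; rewrite ler_norml; lra.
exists (sup S) => s Ps.
have h1 : u s - v s <= sup S.
  by apply: ub_le_sup; [exists (u s + v s); exact: ubS|exists s].
have h2 : sup S <= u s + v s.
  by apply: ge_sup; [exists (u t0 - v t0), t0|exact: ubS].
by rewrite ler_norml; lra.
Qed.

Lemma complex_limit (T : Type) (P : set T) (u : T -> R[i]) (v : T -> R) : P !=set0 ->
  (forall s t, P s -> P t -> cmod (u s - u t) <= v s + v t) ->
  exists L, forall s, P s -> cmod (u s - L) <= 2 * v s.
Proof.
move=> P0 H.
have [|a ha] := real_limit (u := fun s => complex.Re (u s)) (v := v) P0.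
  move=> s t Ps Pt; apply: le_trans (H _ _ Ps Pt).
  by have := cmod_le_Re (u s - u t); case: (u s) (u t) => ? ? [].
have [|b hb] := real_limit (u := fun s => complex.Im (u s)) (v := v) P0.
  move=> s t Ps Pt; apply: le_trans (H _ _ Ps Pt).
  by have := cmod_le_Im (u s - u t); case: (u s) (u t) => ? ? [].
exists (Complex a b) => s Ps; have := ha s Ps; have := hb s Ps.
case: (u s) => x y /= h1 h2; rewrite complexB.
by apply: le_trans (cmod_Complex_le _ _) _; lra.
Qed.

(* The derivatives at c of two difference quotients x |-> (f (x + h) - f x) / h
   are compared by the Cauchy estimate. *)
Lemma hol_deriv_bounded f c r M : 0 < r -> holomorphic_on (disc c r) f ->
  (forall z, disc c r z -> cmod (f z) <= M) ->
  exists l, cderiv (derive1 f) c l.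
Proof.
move=> r0 hf fM.
have M0 : 0 <= M by apply: le_trans (fM c (disc_center _ r0)); exact: cmod_ge0.
have fL := deriv_lipschitz r0 hf fM.
set K := 24 * 48 * 8 * M / r ^+ 2 in fL.
have K0 : 0 <= K by apply: divr_ge0; [lra|rewrite exprn_ge0 // ltW].
clearbody K.
pose P := [set h | h != 0 /\ cmod h < r / 16].
pose u h := (derive1 f (c + h) - derive1 f c) / h.
have r16 : 0 < r / 16 by lra.
pose phi h x := (f (x + h) - f x) / h.
have hf16 : holomorphic_on (disc c (r / 8)) f.
  by apply: holS hf; apply: disc_subr; lra.
(* The mean value inequality for y |-> f y - f'(x) y, combined with the Lipschitz bound on f', makes
   the difference quotients approach f' uniformly. *)
have phiE h x : P h -> disc c (r / 16) x -> cmod (phi h x - derive1 f x) <= K * cmod h.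
  move=> [h0 hr] hx.
  have xin : disc c (r / 8) x by apply: disc_subr hx; lra.
  have xhin y : cmod y <= cmod h -> disc c (r / 8) (x + y).
    move=> hy; rewrite /disc /= (_ : x + y - c = (x - c) + y); last by ring.
    apply: le_lt_trans (cmodD _ _) _.
    by move: hx; rewrite /disc /=; lra.
  pose g y := f y - derive1 f x * y.
  have gl : cmod (g (x + h) - g x) <= (K * cmod h) * cmod (x + h - x).
    apply: mean_value => t /andP[t0 t1].
    have -> : x + t%:C%C * (x + h - x) = x + t%:C%C * h by ring.
    have th : cmod (t%:C%C * h) <= cmod h.
      by rewrite cmodM cmod_real ger0_norm // ler_piMl // cmod_ge0.
    exists (derive1 f (x + t%:C%C * h) - derive1 f x).
      apply: cderivD; first exact: hol_cderiv hf16 (xhin _ th).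
      apply: cderivN; apply: cderiv_eq (cderivM (cderivC _ _) (cderivId _)).
      by rewrite mulr1 mulr0 addr0.
    apply: le_trans (fL _ _ xin (xhin _ th)) _.
    by rewrite addrAC subrr add0r ler_wpM2l.
  have hn : 0 < cmod h by rewrite cmod_gt0.
  have -> : phi h x - derive1 f x = (g (x + h) - g x) / h.
    by rewrite /phi /g; field.
  rewrite cmodM cmodV ler_pdivrMr //; apply: le_trans gl _.
  by rewrite addrAC subrr add0r.
have uP s t : P s -> P t -> cmod (u s - u t) <= (24 * K / (r / 16) * cmod s + 24 * K / (r / 16) * cmod t).
  move=> Ps Pt.
  have dphi h : P h -> forall x, disc c (r / 16) x ->
      cderiv (phi h) x ((derive1 f (x + h) - derive1 f x) / h).
    move=> [h0 hr] x hx.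
    have xin : disc c (r / 8) x by apply: disc_subr hx; lra.
    have xhin : disc c (r / 8) (x + h).
      rewrite /disc /= (_ : x + h - c = (x - c) + h); last by ring.
      apply: le_lt_trans (cmodD _ _) _.
      by move: hx; rewrite /disc /=; lra.
    apply: cderiv_eq; last first.
      apply: cderivM; last exact: cderivC.
      apply: cderivD; last by apply: cderivN; exact: hol_cderiv hf16 xin.
      apply: (@cderiv_comp _ f (fun y => y + h)); first exact: hol_cderiv hf16 xhin.
      exact: (cderivD (cderivId _) (cderivC _ _)).
    by rewrite addr0 mulr1 mulr0 add0r mulrC.
  have cc := disc_center c r16.
  have := @cauchy_estimate _ (fun x => phi s x - phi t x) c (r / 16)
    (K * cmod s + K * cmod t) _ r16 _ _
    (cderivD (dphi _ Ps _ cc) (cderivN (dphi _ Pt _ cc))).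
  have -> : 24 * (K * cmod s + K * cmod t) / (r / 16) =
    24 * K / (r / 16) * cmod s + 24 * K / (r / 16) * cmod t by field; lra.
  apply.
  - by move=> x hx; eexists; exact: (cderivD (dphi _ Ps _ hx) (cderivN (dphi _ Pt _ hx))).
  - move=> x hx; have := phiE _ _ Ps hx; have := phiE _ _ Pt hx.
    have -> : phi s x - phi t x = (phi s x - derive1 f x) - (phi t x - derive1 f x) by ring.
    by have := cmodD (phi s x - derive1 f x) (- (phi t x - derive1 f x)); rewrite cmod_opp; lra.
have P0 : P !=set0.
  exists (r / 32)%:C%C; split; first by rewrite -cmod_gt0 cmod_real gtr0_norm; lra.
  by rewrite cmod_real gtr0_norm; lra.
have [l hl] := complex_limit P0 uP.
set K' := 24 * K / (r / 16) in hl.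
have K'0 : 0 <= K' by rewrite /K' divr_ge0 ?mulr_ge0 // ltW.
exists l => e e0; have e1 : 0 < e / (2 * K' + 1) by apply: divr_gt0 => //; lra.
exists (Num.min (r / 16) (e / (2 * K' + 1))); first by rewrite lt_min r16.
move=> w; rewrite lt_min => /andP[w1].
rewrite ltr_pdivlMr => [w2|]; last lra.
have [->|wc] := eqVneq w c; first by rewrite !subrr mulr0 subr0 cmod0 mulr0.
have wc0 : w - c != 0 by rewrite subr_eq0.
have Pw : P (w - c) by split.
have := hl (w - c) Pw.
have -> : u (w - c) - l = (derive1 f w - derive1 f c - l * (w - c)) / (w - c).
  by rewrite /u (addrC c) subrK [RHS]mulrBl mulfK.
rewrite cmodM cmodV ler_pdivrMr ?cmod_gt0 // => /le_trans; apply.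
by rewrite ler_wpM2r ?cmod_ge0 //; have := cmod_ge0 (w - c); nra.
Qed.

Lemma cderiv_locally_bounded f c l : cderiv f c l ->
  exists2 d, 0 < d & forall z, disc c d z -> cmod (f z) <= cmod (f c) + 1.
Proof.
move=> /cderiv_ccont /(_ 1 ltr01) [d d0 hd]; exists d => // z /hd h.
rewrite -[f z](subrK (f c)); apply: le_trans (cmodD _ _) _.
by rewrite addrC lerD2l ltW.
Qed.

Lemma hol_deriv f c r : 0 < r -> holomorphic_on (disc c r) f ->
  exists l, cderiv (derive1 f) c l.
Proof.
move=> r0 hf; have [d d0 fM] := cderiv_locally_bounded (hol_cderiv hf (disc_center c r0)).
have m0 : 0 < Num.min d r by rewrite lt_min d0.
apply: (@hol_deriv_bounded f c (Num.min d r)) => //.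
  by apply: holS hf; apply: disc_subr; rewrite ge_min lexx orbT.
by move=> z hz; apply: fM; apply: disc_subr hz; rewrite ge_min lexx.
Qed.

(** The remainder g has derivative f'(x) - f'(c) - l (x - c), at most e |z - c| on the segment from
    c to z; the mean value inequality supplies the second factor |z - c|. *)
Lemma taylor2 f c r l : 0 < r -> holomorphic_on (disc c r) f ->
  cderiv (derive1 f) c l -> forall e, 0 < e -> exists2 d, 0 < d &
  forall z, disc c d z ->
    cmod (f z - f c - derive1 f c * (z - c) - l / 2 * (z - c) ^+ 2) <=
    e * cmod (z - c) ^+ 2.
Proof.
move=> r0 hf dl e e0; have [d d0 hd] := dl e e0.
exists (Num.min d r); first by rewrite lt_min d0.
move=> z; rewrite /disc /= lt_min => /andP[zd zr].
pose g x := f x - derive1 f c * (x - c) - l / 2 * ((x - c) * (x - c)).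
have -> : f z - f c - derive1 f c * (z - c) - l / 2 * (z - c) ^+ 2 = g z - g c.
  by rewrite /g; ring.
rewrite expr2 mulrA; apply: mean_value => t t01.
set x := c + _.
have xz : cmod (x - c) <= cmod (z - c).
  have -> : x - c = t%:C%C * (z - c) by rewrite /x; ring.
  have /andP[t0 t1] := t01.
  by rewrite cmodM cmod_real ger0_norm // ler_piMl // cmod_ge0.
exists (derive1 f x - derive1 f c - l * (x - c)).
  have dxc : cderiv (fun x => x - c) x 1.
    by apply: cderiv_eq (cderivD (cderivId _) (cderivC _ _)); rewrite addr0.
  have dfx : cderiv f x (derive1 f x).
    by apply: hol_cderiv hf _; exact: le_lt_trans xz zr.
  apply: cderiv_eq (cderivD (cderivD dfx (cderivN (cderivM (cderivC _ _) dxc)))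
    (cderivN (cderivM (cderivC _ _) (cderivM dxc dxc)))).
  by move: (derive1 f x) (derive1 f c) => a b; field.
apply: le_trans (hd _ (le_lt_trans xz zd)) _.
by rewrite ler_wpM2l // ltW.
Qed.

Definition quotient_at f c z := if z == c then derive1 f c else (f z - f c) / (z - c).

Lemma quotient_atE f c z : (z - c) * quotient_at f c z = f z - f c.
Proof.
rewrite /quotient_at; case: eqVneq => [->|zc]; first by rewrite !subrr mul0r.
by rewrite mulrC divfK // subr_eq0.
Qed.

(** At c the second order expansion gives the derivative l / 2, where l = f''(c). At z different
    from c, the quotient rule applies on the disc of radius |z - c| about z, which avoids c. *)
Lemma quotient_at_hol f c r : 0 < r -> holomorphic_on (disc c r) f ->
  holomorphic_on (disc c r) (quotient_at f c).
Proof.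
move=> r0 hf; apply: cderiv_hol => z hz.
have [->|zc] := eqVneq z c.
  have [l hl] := hol_deriv r0 hf; exists (l / 2) => e e0.
  have [d d0 hd] := taylor2 r0 hf hl e0; exists d => // w wd.
  have [->|wc] := eqVneq w c; first by rewrite !subrr mulr0 subr0 cmod0 mulr0.
  have wc0 : w - c != 0 by rewrite subr_eq0.
  have := hd _ wd.
  rewrite /quotient_at eqxx (negbTE wc).
  have -> : (f w - f c) / (w - c) - derive1 f c - l / 2 * (w - c) =
    (f w - f c - derive1 f c * (w - c) - l / 2 * (w - c) ^+ 2) / (w - c).
    by move: (derive1 f c) => a; field.
  move=> H; rewrite cmodM cmodV ler_pdivrMr ?cmod_gt0 //.
  by apply: le_trans H _; rewrite expr2 mulrA.
have zc0 : z - c != 0 by rewrite subr_eq0.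
have dzc : cderiv (fun x => x - c) z 1.
  by apply: cderiv_eq (cderivD (cderivId _) (cderivC _ _)); rewrite addr0.
eexists; apply: (@cderiv_near _ (fun w => (f w - f c) / (w - c)) _ _ _ (cmod (z - c))).
- by rewrite cmod_gt0.
- move=> w wz; rewrite /quotient_at; case: eqVneq => // wc.
  by move: wz; rewrite wc cmod_sub ltxx.
- have H1 := cderivD (hol_cderiv hf hz) (cderivC (- f c) z).
  exact: cderivM H1 (cderivV (f := fun x => x - c) zc0 dzc).
Qed.

(** Within r / 2 of c the bound is the mean value inequality with the Cauchy estimate for f';
    farther out, dividing by z - c costs at most a factor 2 / r. The factor 48 / r does not depend
    on f, so the division can be iterated. *)
Lemma quotient_at_bound f c r M : 0 < r -> holomorphic_on (disc c r) f ->
  f c = 0 -> (forall z, disc c r z -> cmod (f z) <= M) ->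
  forall z, disc c r z -> cmod (quotient_at f c z) <= 48 / r * M.
Proof.
move=> r0 hf fc fM z hz.
have M0 : 0 <= M by apply: le_trans (fM c (disc_center _ r0)); exact: cmod_ge0.
have r20 : 0 < r / 2 by lra.
have r2 : r / 2 < r by lra.
have fb := deriv_bound r20 r2 hf fM.
have E : 24 * M / (r - r / 2) = 48 / r * M by field; lra.
rewrite E in fb.
rewrite /quotient_at; case: eqVneq => [_|zc]; first by apply: fb; apply: disc_center; lra.
have zn : 0 < cmod (z - c) by rewrite cmod_gt0 subr_eq0.
rewrite cmodM cmodV ler_pdivrMr //.
have [z2|z2] := ltP (cmod (z - c)) (r / 2).
  have hf2 : holomorphic_on (disc c (r / 2)) f.
    by apply: holS hf; apply: disc_subr; lra.
  by apply: mean_value_disc hf2 fb _ z2; apply: disc_center; lra.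
rewrite fc subr0; apply: le_trans (fM _ hz) _.
have -> : 48 / r * M * cmod (z - c) = M * (48 * cmod (z - c) / r) by field; lra.
by apply: ler_peMr => //; rewrite ler_pdivlMr //; lra.
Qed.

(* If the zeros of f accumulate at c, then f can be divided by (z - c)^n for
   every n, and the quotients grow at most geometrically in n. *)
Lemma zeros_isolated f c r : 0 < r -> holomorphic_on (disc c r) f ->
  (exists2 d, 0 < d & forall z, disc c d z -> f z = 0) \/
  (exists2 d, 0 < d & forall z, disc c d z -> z != c -> f z != 0).
Proof.
move=> r0 hf; have [|acc] := pselect (exists2 d, 0 < d &
  forall z, disc c d z -> z != c -> f z != 0); [by right|left].
have {}acc d : 0 < d -> exists z, [/\ disc c d z, z != c & f z = 0].
  move=> d0; apply: contrapT => H; apply: acc; exists d => // z hz zc.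
  by apply/eqP => fz; apply: H; exists z.
have [d d0 fM] := cderiv_locally_bounded (hol_cderiv hf (disc_center c r0)).
set M := cmod (f c) + 1 in fM.
have [s [s0 sd sr]] : exists s : R, [/\ 0 < s, s <= d & s <= r].
  by exists (Num.min d r); rewrite lt_min d0 r0 !ge_min !lexx orbT.
have {}fM z : disc c s z -> cmod (f z) <= M.
  by move=> hz; apply: fM; apply: disc_subr hz.
have {}hf : holomorphic_on (disc c s) f by apply: holS hf; exact: disc_subr.
have H n : exists g, [/\ holomorphic_on (disc c s) g,
    forall z, f z = (z - c) ^+ n * g z &
    forall z, disc c s z -> cmod (g z) <= (48 / s) ^+ n * M].
  elim: n => [|n [g [hg fg gM]]].
    by exists f; split => // z; rewrite ?expr0 ?mul1r //; exact: fM.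
  (* Zeros of f other than c are zeros of g and accumulate at c, so continuity forces g c = 0 and
     one more factor can be split off. *)
  have gc : g c = 0.
    apply/eqP; rewrite -cmod_eq0 eq_le cmod_ge0 andbT leNgt; apply/negP => gp.
    have [b b0 hb] := cderiv_ccont (hol_cderiv hg (disc_center c s0)) gp.
    have [z [hz zc fz]] := acc b b0.
    have gz : g z = 0.
      move/eqP: fz; rewrite fg mulf_eq0 expf_eq0 subr_eq0 (negbTE zc) andbF /=.
      by move/eqP.
    by have := hb z hz; rewrite gz sub0r cmod_opp ltxx.
  exists (quotient_at g c); split.
  - exact: quotient_at_hol.
  - by move=> z; rewrite fg exprSr -mulrA quotient_atE gc subr0.
  - move=> z hz; rewrite exprS -mulrA; exact: quotient_at_bound.
(* At this distance |z - c| (48 / s) is at most 1 / 2, so |f z| 2 ^ n stays below M for all n. *)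
exists (s / 96); first lra.
move=> z hz; apply/eqP; rewrite -cmod_eq0 eq_le cmod_ge0 andbT.
have zs : disc c s z by apply: disc_subr hz; lra.
have B n : cmod (f z) * 2 ^+ n <= M.
  have [g [_ fg gM]] := H n; rewrite fg cmodM cmodX.
  have M0 : 0 <= M by have := cmod_ge0 (f c); rewrite /M; lra.
  apply: (@le_trans _ _ ((cmod (z - c) * (48 / s) * 2) ^+ n * M)).
    have {}gM := gM z zs; set k := 48 / s in gM *.
    have -> : (cmod (z - c) * k * 2) ^+ n * M =
      cmod (z - c) ^+ n * (k ^+ n * M) * 2 ^+ n by rewrite !exprMn; ring.
    rewrite ler_wpM2r ?exprn_ge0 //.
    by rewrite ler_wpM2l // exprn_ge0 // cmod_ge0.
  rewrite ler_piMl // exprn_ile1 //.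
    by rewrite !mulr_ge0 ?cmod_ge0 ?invr_ge0 // ltW.
  have -> : cmod (z - c) * (48 / s) * 2 = cmod (z - c) * 96 / s by field; lra.
  by rewrite ler_pdivrMr // mul1r; move: hz; rewrite /disc /=; lra.
rewrite leNgt; apply/negP => fz.
pose n := Num.bound (M / cmod (f z)).
have M0 : 0 <= M by have := cmod_ge0 (f c); rewrite /M; lra.
have : M / cmod (f z) < n%:R by apply: archi_boundP; rewrite divr_ge0 // ltW.
rewrite ltr_pdivrMr // ltNge => /negP; apply.
apply: le_trans (B n); rewrite mulrC ler_wpM2l ?cmod_ge0 //.
by rewrite -natrX ler_nat ltnW // ltn_expl.
Qed.

End Holomorphic.

(** * Local inverses and the Schwarz lemma *)

Section LocalInverse.
Variable R : realType.
Implicit Types (r M e d : R) (f g q : R[i] -> R[i]) (z w l c : R[i]).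
Implicit Types A U V W : set R[i].

Lemma cderiv_inverse f q w l d : 0 < d ->
  (forall x, disc w d x -> f (q x) = x) -> ccont q w ->
  cderiv f (q w) l -> l != 0 -> cderiv q w l^-1.
Proof.
move=> d0 fq cq df l0 e e0; set a := cmod l.
have a0 : 0 < a by rewrite /a cmod_gt0.
(* The bound a / 2 makes q Lipschitz at w with constant 2 / a; the bound e a^2 / 2 absorbs that
   factor and the division by l. *)
have [e1 [e10 e1a e1e]] : exists e1 : R, [/\ 0 < e1, e1 <= a / 2 & e1 <= e * a ^+ 2 / 2].
  exists (Num.min (a / 2) (e * a ^+ 2 / 2)).
  rewrite lt_min !ge_min !lexx orbT; split => //.
  by apply/andP; split; rewrite !divr_gt0 ?mulr_gt0 ?exprn_gt0.
have [d1 d10 h1] := df e1 e10.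
have [d2 d20 h2] := cq d1 d10.
exists (Num.min d d2); first by rewrite lt_min d0.
move=> x; rewrite lt_min => /andP[xd /h2 /h1].
rewrite (fq x xd) (fq w (disc_center _ d0)).
set D := q x - q w; set n := cmod (x - w) => H.
have D2 : cmod D <= 2 / a * n.
  have T : a * cmod D <= cmod (x - w - l * D) + n.
    have := cmod_ge_sub (l * D) (x - w).
    by rewrite (cmod_sub (l * D)) cmodM lerBlDr.
  have : a * cmod D <= a / 2 * cmod D + n.
    apply: le_trans T _; rewrite lerD2r; apply: le_trans H _.
    by rewrite ler_wpM2r // cmod_ge0.
  move=> T2; rewrite mulrAC ler_pdivlMr //; lra.
have -> : D - l^-1 * (x - w) = - l^-1 * (x - w - l * D) by field.
rewrite cmodM cmod_opp cmodV -/a mulrC ler_pdivrMr //.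
apply: le_trans H _.
apply: (@le_trans _ _ ((e * a ^+ 2 / 2) * (2 / a * n))).
  by apply: ler_pM => //; rewrite ?cmod_ge0 // ltW.
by rewrite le_eqVlt; apply/orP; left; apply/eqP; field; rewrite gt_eqF.
Qed.

Lemma hol_derive1 A f : open A -> holomorphic_on A f -> holomorphic_on A (derive1 f).
Proof.
move=> /open_discP oA hf; apply: cderiv_hol => z /oA [e e0 he].
by apply: (hol_deriv e0); apply: holS hf.
Qed.

Lemma ccont_comp f g z : ccont f (g z) -> ccont g z -> ccont (fun x => f (g x)) z.
Proof.
move=> hf hg e /hf [d d0 hd]; have [d' d'0 hd'] := hg d d0.
by exists d' => // w /hd' /hd.
Qed.

Lemma ccont_nbhd V f z : open V -> V (f z) -> ccont f z ->
  exists2 d, 0 < d & forall x, disc z d x -> V (f x).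
Proof.
move=> /open_discP oV /oV [e e0 he] cf; have [d d0 hd] := cf e e0.
by exists d => // x /hd /he.
Qed.

Definition local_inverse U V f q :=
  [/\ forall w, V w -> U (q w) /\ f (q w) = w,
      forall z, U z -> V (f z) /\ q (f z) = z &
      forall w, V w -> ccont q w].

(* At a zero c of f' the inverse q is still differentiable off the point f c,
   as the zeros of f' are isolated; by continuity the singularity is removable,
   and then the chain rule contradicts f' c = 0. *)
Lemma local_inverse_deriv_neq0 U V f q : open U -> open V ->
  holomorphic_on U f -> local_inverse U V f q ->
  forall c, U c -> derive1 f c != 0.
Proof.
move=> oU oV hf [qV fU cq] c Uc; apply/negP => /eqP f'c.
have hf' := hol_derive1 oU hf.
have [r r0 Ur] := (open_discP U).1 oU c Uc.
have [[d d0 Z]|[d d0 Z]] := zeros_isolated r0 (holS Ur hf').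
  (* If f' vanishes near c, then f is constant there, contradicting its injectivity on U. *)
  have [s [s0 sd sr]] : exists s : R, [/\ 0 < s, s <= d & s <= r].
    by exists (Num.min d r); rewrite lt_min d0 r0 !ge_min !lexx orbT.
  pose x := c + (s / 2)%:C%C.
  have xc : x - c = (s / 2)%:C%C by rewrite /x addrC addKr.
  have xs : disc c s x by rewrite /disc /= xc cmod_real gtr0_norm; lra.
  have hs : holomorphic_on (disc c s) f by apply: holS hf => y hy; exact: Ur (disc_subr sr hy).
  have := @mean_value_disc _ f c s 0 c x hs _ (disc_center _ s0) xs.
  rewrite mul0r => /(_ _) H.
  have fx : f x = f c.
    apply/eqP; rewrite -subr_eq0 -cmod_eq0 eq_le cmod_ge0 andbT; apply: H => z hz.
    by rewrite Z ?cmod0 //; apply: disc_subr hz.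
  have Ux : U x by exact: Ur (disc_subr sr xs).
  have [_ qx] := fU x Ux; have [_ qc] := fU c Uc.
  have xc' : x = c by rewrite -qx fx qc.
  move: xc; rewrite xc' subrr => /(congr1 (@cmod R)).
  by rewrite cmod0 cmod_real gtr0_norm; lra.
have [Vc qc] := fU c Uc; set w0 := f c in Vc qc *.
have [b b0 Hb] : exists2 b, 0 < b & forall x, disc w0 b x -> V x /\ disc c d (q x).
  have [b1 b10 h1] := (open_discP V).1 oV w0 Vc.
  have [b2 b20 h2] := cq w0 Vc d d0.
  exists (Num.min b1 b2); first by rewrite lt_min b10.
  move=> x; rewrite /disc /= lt_min => /andP[/h1 Vx /h2]; rewrite qc.
  by split.
(* The extra factor x - w0 makes k differentiable at w0 with derivative 0 by mere continuity of q;
   dividing it out again shows that q - c is holomorphic across w0. *)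
pose k x := (x - w0) * (q x - c).
have dk1 x : cderiv (fun x => x - w0) x 1.
  by apply: cderiv_eq (cderivD (cderivId _) (cderivC _ _)); rewrite addr0.
have k0 : cderiv k w0 0.
  move=> e e0; have [b' b'0 hb'] := cq w0 Vc e e0.
  exists b' => // x /hb'; rewrite qc => h.
  rewrite /k subrr !mul0r !subr0 cmodM mulrC ler_wpM2r ?cmod_ge0 //; exact: ltW.
have hk : holomorphic_on (disc w0 b) k.
  apply: cderiv_hol => x hx; have [Vx qx] := Hb x hx.
  have [->|xw] := eqVneq x w0; first by exists 0.
  have [Uqx fqx] := qV x Vx.
  have qxc : q x != c by apply: contra_neq xw => qxc; rewrite -fqx qxc.
  have [b1 b10 h1] := (open_discP V).1 oV x Vx.
  have dq : cderiv q x (derive1 f (q x))^-1.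
    apply: (cderiv_inverse b10) (hol_cderiv hf Uqx) _; last exact: Z.
      by move=> y /h1 /qV [].
    exact: cq.
  by eexists; apply: cderivM (dk1 x) (cderivD dq (cderivC _ _)).
have hq := quotient_at_hol b0 hk.
have qE x : quotient_at k w0 x = q x - c.
  rewrite /quotient_at; case: eqVneq => [->|xw].
    by rewrite (cderivE k0) qc subrr.
  by rewrite /k subrr mul0r subr0 mulrC mulKf // subr_eq0.
have [l dq] : exists l, cderiv q w0 l.
  exists (derive1 (quotient_at k w0) w0 + 0).
  apply: (cderiv_near b0 _ (cderivD (hol_cderiv hq (disc_center _ b0)) (cderivC c _))).
  by move=> x _; rewrite qE subrK.
have fq : cderiv (fun x => f (q x)) w0 (derive1 f c * l).
  by apply: cderiv_comp dq; rewrite qc; exact: hol_cderiv hf Uc.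
have := cderivE (cderiv_near b0 (fun x hx => proj2 (qV x (proj1 (Hb x hx)))) fq).
rewrite f'c mul0r (cderivE (cderivId w0)) => /eqP.
by rewrite oner_eq0.
Qed.

Lemma local_inverse_cderiv U V f q : open U -> open V ->
  holomorphic_on U f -> local_inverse U V f q ->
  forall w, V w -> cderiv q w (derive1 f (q w))^-1.
Proof.
move=> oU oV hf fq w Vw; have [qV fU cq] := fq.
have [b b0 h] := (open_discP V).1 oV w Vw.
have [Uq _] := qV w Vw.
apply: (cderiv_inverse b0) (hol_cderiv hf Uq) _; last 1 first.
- exact: local_inverse_deriv_neq0 fq _ Uq.
- by move=> y /h /qV [].
- exact: cq.
Qed.

(* The n-th iterate of g has derivative g'(0)^n at 0, so that the Cauchy
   estimate bounds all powers of g'(0) by the same constant. *)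
Lemma schwarz g : holomorphic_on (disc 0 1) g ->
  (forall z, disc 0 1 z -> disc 0 1 (g z)) -> g 0 = 0 -> cmod (derive1 g 0) <= 1.
Proof.
move=> hg gD g0; set x := cmod _.
have z0 := disc_center (0 : R[i]) ltr01.
have H n : exists G, [/\ holomorphic_on (disc 0 1) G,
    forall z, disc 0 1 z -> disc 0 1 (G z), G 0 = 0 & cderiv G 0 (derive1 g 0 ^+ n)].
  elim: n => [|n [G [hG GD G0 dG]]].
    exists id; split; [|by []|by []|rewrite expr0; exact: cderivId].
    by apply: cderiv_hol => z _; exists 1; exact: cderivId.
  exists (fun z => g (G z)); split.
  - apply: cderiv_hol => z hz; eexists.
    exact: cderiv_comp (hol_cderiv hg (GD z hz)) (hol_cderiv hG hz).
  - by move=> z /GD /gD.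
  - by rewrite G0.
  - by rewrite exprS; apply: cderiv_comp dG; rewrite G0; exact: hol_cderiv hg z0.
have B n : x ^+ n <= 24.
  have [G [hG GD G0 dG]] := H n.
  have := @cauchy_estimate _ G 0 1 1 _ ltr01 _ _ dG.
  rewrite mulr1 divr1 cmodX; apply.
    by move=> z hz; exists (derive1 G z); exact: hol_cderiv hG hz.
  by move=> z /GD; rewrite /disc /= subr0 => /ltW.
rewrite leNgt; apply/negP => x1.
(* Bernoulli's inequality: if x > 1, its powers exceed the bound 24. *)
have C n : 1 + n%:R * (x - 1) <= x ^+ n.
  elim: n => [|n IH]; first by rewrite mul0r addr0 expr0.
  rewrite exprS -natr1; have n0 : 0 <= n%:R :> R by [].
  have x0 : 0 < x - 1 by lra.
  apply: le_trans (ler_wpM2l _ IH); last lra.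
  have : 0 <= n%:R * (x - 1) * (x - 1) by rewrite !mulr_ge0 // ltW.
  by move: (n%:R) => m; lra.
have x0 : 0 < x - 1 by lra.
pose n := Num.bound (24 / (x - 1)).
have : 24 / (x - 1) < n%:R by apply: archi_boundP; rewrite divr_ge0 // ltW.
rewrite ltr_pdivrMr //; have := C n; have := B n; lra.
Qed.

End LocalInverse.

(** * Lifting through a covering *)

Section Lifting.
Variable R : realType.
Implicit Types (r e d s t : R) (f g p q : R[i] -> R[i]) (z w c x y : R[i]).
Implicit Types A U V W D : set R[i].

(** The sheets over an evenly covered V, each with an inverse branch of p; disjointness appears as
    the equality of two sheets that share a point. *)
Definition sheets p D V (F : set (set R[i])) :=
  [/\ forall U, F U -> [/\ open U, U `<=` D & exists q, local_inverse U V p q],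
      forall U U' x, F U -> F U' -> U x -> U' x -> U = U' &
      forall x, D x -> V (p x) -> exists2 U, F U & U x].

Lemma covering_sheets D A p : covering_map D A p -> forall y, A y ->
  exists V F, [/\ open V, V y, V `<=` A & sheets p D V F].
Proof.
move=> [_ _ H] y /H [V [oV Vy VA [F [FU Ftriv FE]]]].
exists V, F; split => //.
have FD U x : F U -> U x -> D x /\ V (p x).
  move=> FU' Ux; have : (\bigcup_(U in F) U) x by exists U.
  by rewrite -FE.
split.
- move=> U hU; have [oU [[pU injU surU] _ [q cq qK]]] := FU U hU.
  split => //; first by move=> x /(FD U x hU) [].
  exists q; split.
  + move=> w Vw; have [x Ux pxw] := surU w Vw.
    have qx : q (p x) = x by apply: qK; exact: mem_set.
    by rewrite -pxw qx.
  + by move=> x Ux; split; [exact: pU|apply: qK; exact: mem_set].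
  + exact/(within_ccont _ oV).
- move=> U U' x hU hU' Ux U'x.
  by apply: Ftriv => //; exists x.
- move=> x Dx Vx; have : (D `&` p @^-1` V) x by split.
  by rewrite FE => -[U hU Ux]; exists U.
Qed.

Definition convex_set W := forall x y t, W x -> W y -> 0 <= t <= 1 ->
  W (x + t%:C%C * (y - x)).

Lemma convex_setI W W' : convex_set W -> convex_set W' -> convex_set (W `&` W').
Proof. by move=> c1 c2 x y t [h1 h2] [h3 h4] ht; split; [exact: c1|exact: c2]. Qed.

Definition lift_on D p f W g :=
  [/\ forall x, W x -> ccont g x, forall x, W x -> D (g x) &
      forall x, W x -> p (g x) = f x].

Lemma lift_onS D p f W W' g : W `<=` W' -> lift_on D p f W' g -> lift_on D p f W g.
Proof. by move=> S [h1 h2 h3]; split=> x /S; [exact: h1|exact: h2|exact: h3]. Qed.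

Lemma segment_near (x y : R[i]) t d : 0 < d -> exists2 b, 0 < b & forall s,
  t - b < s -> s < t + b -> cmod (x + s%:C%C * (y - x) - (x + t%:C%C * (y - x))) < d.
Proof.
move=> d0; have n0 := cmod_ge0 (y - x).
have n1 : 0 < cmod (y - x) + 1 by lra.
exists (d / (cmod (y - x) + 1)); first exact: divr_gt0.
move=> s s1 s2.
have -> : x + s%:C%C * (y - x) - (x + t%:C%C * (y - x)) = (s - t)%:C%C * (y - x).
  by rewrite realcB; ring.
rewrite cmodM cmod_real.
have : `|s - t| < d / (cmod (y - x) + 1) by rewrite ltr_norml; lra.
rewrite ltr_pdivlMr //; have := normr_ge0 (s - t); lra.
Qed.

(** Along the segment from a to b, each lift stays in one sheet near a given parameter. If the lifts
    agree at some nearby parameter, the two sheets share a point and are equal, and injectivity of p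
    on that sheet carries the agreement on. *)
Lemma lift_unique D A p f W g1 g2 : covering_map D A p -> convex_set W ->
  (forall x, W x -> A (f x)) -> lift_on D p f W g1 -> lift_on D p f W g2 ->
  forall a b, W a -> W b -> g1 a = g2 a -> g1 b = g2 b.
Proof.
move=> cov cW fA [c1 D1 p1] [c2 D2 p2] a b Wa Wb gab.
pose x t := a + t%:C%C * (b - a).
have x1 : x 1 = b by rewrite /x (_ : 1%:C%C = 1) // mul1r addrC subrK.
have x0 : x 0 = a by rewrite /x (_ : 0%:C%C = 0) // mul0r addr0.
rewrite -x1; apply: (@unit_itv_induction _ (fun t => g1 (x t) = g2 (x t))); first by rewrite x0.
move=> t t01; have Wt := cW a b t Wa Wb t01; rewrite -/(x t) in Wt.
have [V [F [oV Vy VA [FU Fu Fc]]]] := covering_sheets cov (fA _ Wt).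
have [U1 F1 U1x] := Fc _ (D1 _ Wt) ltac:(by rewrite p1).
have [U2 F2 U2x] := Fc _ (D2 _ Wt) ltac:(by rewrite p2).
have [ou1 _ [q1 [_ q1K _]]] := FU _ F1.
have [ou2 _ _] := FU _ F2.
have [d1 d10 h1] := ccont_nbhd ou1 U1x (c1 _ Wt).
have [d2 d20 h2] := ccont_nbhd ou2 U2x (c2 _ Wt).
have [b1 b10 k1] := segment_near a b t d10.
have [b2 b20 k2] := segment_near a b t d20.
exists (Num.min b1 b2); first by rewrite lt_min b10.
have near s : t - Num.min b1 b2 < s -> s < t + Num.min b1 b2 ->
    U1 (g1 (x s)) /\ U2 (g2 (x s)).
  move=> s1 s2.
  have m1 : Num.min b1 b2 <= b1 by rewrite ge_min lexx.
  have m2 : Num.min b1 b2 <= b2 by rewrite ge_min lexx orbT.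
  by split; [apply/h1/k1; lra|apply/h2/k2; lra].
have m0 : 0 < Num.min b1 b2 by rewrite lt_min b10.
move=> s s' s0 s1 ts st ts' s't E.
have [/andP[t0 t1]] := t01.
have [u1 u2] := near s ltac:(lra) ltac:(lra).
have [v1 v2] := near s' ltac:(lra) ltac:(lra).
have UU : U1 = U2 by apply: Fu F1 F2 u1 _; rewrite E.
have Ws : W (x s') by apply: cW => //; lra.
rewrite -UU in v2.
have [_ <-] := q1K _ v1; have [_ <-] := q1K _ v2.
by rewrite p1 // p2.
Qed.

Lemma ccont_near f g x d : 0 < d -> (forall y, disc x d y -> f y = g y) ->
  ccont f x -> ccont g x.
Proof.
move=> d0 fg cf e e0; have [b b0 hb] := cf e e0.
exists (Num.min d b); first by rewrite lt_min d0.
move=> y; rewrite lt_min => /andP[yd /hb].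
by rewrite !fg //; exact: disc_center.
Qed.

(** The e-neighbourhood of the segment [0, s z]. It is convex, and so are its intersections with
    discs and other tubes, which is what [lift_unique] requires. *)
Definition tube z s e : set R[i] :=
  [set x | exists2 t, 0 <= t <= s & cmod (x - t%:C%C * z) < e].

Lemma tube_convex z s e : convex_set (tube z s e).
Proof.
move=> x y t [a /andP[a0 a1] ha] [b /andP[b0 b1] hb] /andP[t0 t1].
exists (a + t * (b - a)); first by apply/andP; split; nra.
have t01 : 0 <= t <= 1 by rewrite t0.
have h0 : disc (0 : R[i]) e (x - a%:C%C * z) by rewrite /disc /= subr0.
have h1 : disc (0 : R[i]) e (y - b%:C%C * z) by rewrite /disc /= subr0.
have := disc_convex t01 h0 h1; rewrite /disc /= subr0.
have -> : (a + t * (b - a))%:C%C = a%:C%C + t%:C%C * (b%:C%C - a%:C%C) :> R[i].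
  by rewrite -realcB -rmorphM -rmorphD.
by move: (a%:C%C) (b%:C%C) (t%:C%C) => A B T; congr (cmod _ < _); ring.
Qed.

Lemma tube_open z s e x : tube z s e x ->
  exists2 d, 0 < d & disc x d `<=` tube z s e.
Proof.
move=> [t ht hx]; exists (e - cmod (x - t%:C%C * z)); first by rewrite subr_gt0.
move=> y hy; exists t => //; apply: le_lt_trans (cmod_dist_trans x _ _) _.
by move: hy; rewrite /disc /=; lra.
Qed.

Lemma tubeS z s s' e e' : s <= s' -> e <= e' -> tube z s e `<=` tube z s' e'.
Proof.
move=> ss ee x [t /andP[t0 t1] h]; exists t; last exact: lt_le_trans ee.
by rewrite t0 (le_trans t1).
Qed.

Lemma disc_convex_set c r : convex_set (disc c r).
Proof. by move=> x y t hx hy ht; exact: disc_convex. Qed.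

(* The lift is extended from the tube around [0, s z] to a thinner tube around
   a longer segment; both pieces are convex, hence agree on their overlap. *)
Lemma tube_lift A D p f z x0 : covering_map D A p -> cmod z < 1 ->
  (forall x, disc 0 1 x -> ccont f x) -> (forall x, disc 0 1 x -> A (f x)) ->
  D x0 -> p x0 = f 0 ->
  exists e, exists g, [/\ 0 < e, e <= 1 - cmod z, lift_on D p f (tube z 1 e) g & g 0 = x0].
Proof.
move=> cov z1 cf fA Dx0 px0; have n0 := cmod_ge0 z.
have tub s e x : s <= 1 -> e <= 1 - cmod z -> tube z s e x -> disc 0 1 x.
  move=> s1 e1 [t /andP[t0 ts] hx]; rewrite /disc /= subr0.
  have -> : x = (x - t%:C%C * z) + t%:C%C * z by ring.
  apply: le_lt_trans (cmodD _ _) _; rewrite cmodM cmod_real ger0_norm //.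
  have : t * cmod z <= 1 * cmod z by rewrite ler_wpM2r //; lra.
  lra.
pose P s := exists e, exists g,
  [/\ 0 < e, e <= 1 - cmod z, lift_on D p f (tube z s e) g & g 0 = x0].
have disc01 : disc (0 : R[i]) 1 0 by exact: disc_center.
apply: (@unit_itv_induction _ P).
  (* For s = 0 the tube is a disc about 0; with a small radius, f maps it into one evenly covered
     set. *)
  have [V [F [oV Vy VA [FU Fu Fc]]]] := covering_sheets cov (fA 0 disc01).
  have [U hU Ux] := Fc _ Dx0 ltac:(by rewrite px0).
  have [oU UD [q [qV qU cq]]] := FU _ hU.
  have [d d0 hd] := ccont_nbhd oV Vy (cf _ disc01).
  exists (Num.min d (1 - cmod z)), (q \o f).
  have T x : tube z 0 (Num.min d (1 - cmod z)) x -> disc 0 1 x /\ V (f x).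
    move=> hx; split; first by apply: tub hx; rewrite ?ler01 // ge_min lexx orbT.
    case: hx => t; rewrite -eq_le eq_sym => /eqP ->.
    by rewrite mul0r lt_min => /andP[/hd].
  split; first by rewrite lt_min d0 subr_gt0.
  - by rewrite ge_min lexx orbT.
  - split=> x /T [x1 Vx] /=.
    + by apply: ccont_comp; [exact: cq|exact: cf].
    + by apply: UD; exact: (qV _ Vx).1.
    + exact: (qV _ Vx).2.
  - by rewrite /= -px0; exact: (qU _ Ux).2.
move=> t /andP[t0 t1]; set y := t%:C%C * z.
have y1 : disc 0 1 y.
  apply: (tub t (1 - cmod z)) => //; exists t; first by rewrite t0 lexx.
  by rewrite subrr cmod0; lra.
have [V [F [oV Vy VA [FU Fu Fc]]]] := covering_sheets cov (fA y y1).
have [d [d0 dz hd]] : exists d, [/\ 0 < d, d <= 1 - cmod z & forall x, disc y d x -> V (f x)].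
  have [d d0 hd] := ccont_nbhd oV Vy (cf _ y1).
  exists (Num.min d (1 - cmod z)).
  rewrite lt_min d0 subr_gt0 z1 ge_min lexx orbT; split => // x hx.
  by apply: hd; apply: disc_subr hx; rewrite ge_min lexx.
have k1 : 0 < cmod z + 1 by lra.
exists (d / 2 / (cmod z + 1)); first by rewrite !divr_gt0.
have near s : t - d / 2 / (cmod z + 1) < s -> s < t + d / 2 / (cmod z + 1) ->
    cmod (s%:C%C * z - y) < d / 2.
  move=> s1 s2; have -> : s%:C%C * z - y = (s - t)%:C%C * z by rewrite realcB /y; ring.
  rewrite cmodM cmod_real.
  have : `|s - t| < d / 2 / (cmod z + 1) by rewrite ltr_norml; lra.
  rewrite ltr_pdivlMr //; have := normr_ge0 (s - t); lra.
have b0 : 0 < d / 2 / (cmod z + 1) by rewrite !divr_gt0.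
move=> s s' s0 s'1 ts st ts' s't [e [g [e0 ez lg g0]]].
have ds := near s ltac:(lra) ltac:(lra).
(* A point of the longer tube beyond parameter s is within [e'] of the segment and thus within d / 2
   + d / 2 of y, where the new branch is defined. *)
pose e' := Num.min e (d / 2).
have e'0 : 0 < e' by rewrite /e' lt_min e0; lra.
have e'e : e' <= e by rewrite /e' ge_min lexx.
have e'd : e' <= d / 2 by rewrite /e' ge_min lexx orbT.
clearbody e'.
have {}lg := lift_onS (tubeS (lexx s) e'e) lg.
have [cg Dg pg] := lg.
have Ts : tube z s e' (s%:C%C * z).
  by exists s; rewrite ?s0 ?lexx // subrr cmod0.
have Bs : disc y d (s%:C%C * z) by rewrite /disc /=; lra.
have [U hU Ux] := Fc _ (Dg _ Ts) ltac:(by rewrite pg //; exact: hd).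
have [oU UD [q [qV qU cq]]] := FU _ hU.
have By x : disc y d x -> disc 0 1 x.
  move=> hx; apply: (tub t d) => //; exists t => //.
  by rewrite t0 lexx.
have lq : lift_on D p f (disc y d) (q \o f).
  split=> x hx /=; have Vx := hd x hx.
  + by apply: ccont_comp; [exact: cq|apply: cf; exact: By].
  + by apply: UD; exact: (qV _ Vx).1.
  + exact: (qV _ Vx).2.
have agree x : tube z s e' x -> disc y d x -> g x = q (f x).
  move=> h1 h2.
  apply: (lift_unique cov (convex_setI (@tube_convex z s e') (@disc_convex_set y d))
    _ (lift_onS (@subIsetl _ _ _) lg) (lift_onS (@subIsetr _ _ _) lq) (a := s%:C%C * z)).
  - by move=> u [_ /By /fA].
  - by split.
  - by split.
  - by rewrite /= -(pg _ Ts); rewrite (qU _ Ux).2.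
pose G x := if `[< tube z s e' x >] then g x else q (f x).
have Gg x : tube z s e' x -> G x = g x by move=> h; rewrite /G asboolT.
have Gq x : disc y d x -> G x = q (f x).
  by move=> h; rewrite /G; case: asboolP => // h'; exact: agree.
have cover x : tube z s' e' x -> tube z s e' x \/ disc y d x.
  move=> [u /andP[u0 u1] hu].
  have [us|us] := leP u s; first by left; exists u; rewrite ?u0.
  right; have du := near u ltac:(lra) ltac:(lra).
  apply: le_lt_trans (cmod_dist_trans (u%:C%C * z) _ _) _; lra.
exists e', G; split => //; first exact: le_trans ez.
- split=> x /cover [hx|hx].
  + have [b b0' hb] := tube_open hx.
    by apply: (ccont_near b0' _ (cg _ hx)) => u /hb hu; rewrite Gg.
  + have [b b0' hb] := disc_open_nbhs d0 hx.
    have [cq' _ _] := lq.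
    by apply: (ccont_near b0' _ (cq' _ hx)) => u /hb hu; rewrite Gq.
  + by rewrite Gg //; exact: Dg.
  + by have [_ Dq _] := lq; rewrite Gq //; exact: Dq.
  + by rewrite Gg // pg.
  + by have [_ _ pq] := lq; rewrite Gq //; exact: pq.
- rewrite Gg //; exists 0; first by rewrite lexx s0.
  by rewrite mul0r subr0 cmod0.
Qed.

(** The lifts on the tubes around the segments [0, z] are glued. They agree on overlaps, because the
    intersection of two tubes is convex and contains 0, where all of them take the value [x0]. *)
Lemma lifting A D p f x0 : covering_map D A p ->
  (forall x, disc 0 1 x -> ccont f x) -> (forall x, disc 0 1 x -> A (f x)) ->
  D x0 -> p x0 = f 0 -> exists2 g, lift_on D p f (disc 0 1) g & g 0 = x0.
Proof.
move=> cov cf fA Dx0 px0.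
have H z : exists eg : R * (R[i] -> R[i]), disc 0 1 z ->
    [/\ 0 < eg.1, eg.1 <= 1 - cmod z, lift_on D p f (tube z 1 eg.1) eg.2 & eg.2 0 = x0].
  have [z1|] := pselect (disc 0 1 z); last by exists (0, id).
  have [|e [g h]] := tube_lift (z := z) cov _ cf fA Dx0 px0.
    by move: z1; rewrite /disc /= subr0.
  by exists (e, g).
have [eg heg] := choice H.
pose W z := tube z 1 (eg z).1.
have W0 z : disc 0 1 z -> W z 0.
  move=> /heg [e0 _ _ _]; exists 0; first by rewrite lexx ler01.
  by rewrite mul0r subr0 cmod0.
have Wz z : disc 0 1 z -> W z z.
  move=> /heg [e0 _ _ _]; exists 1; first by rewrite lexx ler01.
  by rewrite (_ : 1%:C%C = 1) // mul1r subrr cmod0.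
have WD z : disc 0 1 z -> W z `<=` disc 0 1.
  move=> /heg [e0 e1 _ _] x [t /andP[t0 t1] hx]; rewrite /disc /= subr0.
  have -> : x = (x - t%:C%C * z) + t%:C%C * z by ring.
  apply: le_lt_trans (cmodD _ _) _; rewrite cmodM cmod_real ger0_norm //.
  have n0 := cmod_ge0 z.
  have : t * cmod z <= 1 * cmod z by rewrite ler_wpM2r.
  lra.
have coh z z' : disc 0 1 z -> disc 0 1 z' -> W z z' -> (eg z').2 z' = (eg z).2 z'.
  move=> hz hz' Wzz'; have [_ _ l1 g1] := heg z hz; have [_ _ l2 g2] := heg z' hz'.
  apply: (lift_unique cov (convex_setI (@tube_convex z' 1 (eg z').1)
    (@tube_convex z 1 (eg z).1)) _ (lift_onS (@subIsetl _ _ _) l2)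
    (lift_onS (@subIsetr _ _ _) l1) (a := 0)).
  - by move=> u [/(WD _ hz') /fA].
  - by split; exact: W0.
  - by split => //; exact: Wz.
  - by rewrite g1 g2.
(* Each point is evaluated in the lift on its own tube; by [coh] the result coincides near z with
   the one lift chosen for z, and so it is continuous. *)
exists (fun z => (eg z).2 z).
  split=> z hz; have [_ _ [cg Dg pg] _] := heg z hz.
  - have [b b0 hb] := tube_open (Wz z hz).
    apply: (ccont_near b0 _ (cg _ (Wz z hz))) => u /hb hu.
    by rewrite (coh z u) //; exact: WD hu.
  - exact: Dg (Wz z hz).
  - exact: pg (Wz z hz).
by have [_ _ _] := heg 0 (disc_center _ ltr01).
Qed.

(** A continuous lift stays locally in one sheet, where it is the composition of f with the
    holomorphic inverse branch of p. *)
Lemma lift_hol D A p f W g : covering_map D A p -> holomorphic_on D p ->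
  open W -> holomorphic_on W f -> (forall x, W x -> A (f x)) ->
  lift_on D p f W g -> holomorphic_on W g.
Proof.
move=> cov hp oW hf fA [cg Dg pg]; apply: cderiv_hol => z Wz.
have [V [F [oV Vy VA [FU Fu Fc]]]] := covering_sheets cov (fA z Wz).
have [U hU Ux] := Fc _ (Dg _ Wz) ltac:(by rewrite pg).
have [oU UD [q lq]] := FU _ hU.
have hpU : holomorphic_on U p by apply: holS hp.
have dq := local_inverse_cderiv oU oV hpU lq Vy.
have [_ qU _] := lq.
have [b b0 hb] := ccont_nbhd oU Ux (cg _ Wz).
have [b' b'0 hb'] := (open_discP W).1 oW z Wz.
eexists; apply: (@cderiv_near _ (fun x => q (f x)) _ _ _ (Num.min b b')).
- by rewrite lt_min b0.
- move=> x; rewrite lt_min => /andP[/hb Ugx /hb' Wx].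
  by rewrite -pg // (qU _ Ugx).2.
- exact: cderiv_comp dq (hol_cderiv hf Wz).
Qed.

End Lifting.

(** * Transport of coverings *)

Section Transport.
Variable R : realType.
Implicit Types (r e d s t : R) (f g p q : R[i] -> R[i]) (z w c x y k : R[i]).
Implicit Types A U V W D : set R[i].

Lemma unit_discE : @unit_disc R = disc 0 1.
Proof.
by apply/seteqP; split=> z; rewrite /unit_disc /disc /= subr0 cmodE.
Qed.

Lemma disc_open c r : open (disc c r).
Proof.
apply/open_discP => z hz; exists (r - cmod (z - c)); first by rewrite subr_gt0.
move=> w hw; apply: le_lt_trans (cmod_dist_trans z _ _) _.
by rewrite -ltrBrDr.
Qed.

Lemma sheets_covering D A p : open D -> (forall x, D x -> ccont p x) -> p @` D = A ->
  (forall y, A y -> exists V F, [/\ open V, V y, V `<=` A & sheets p D V F]) ->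
  covering_map D A p.
Proof.
move=> oD cp pDA H; split => //; first exact/within_ccont.
move=> y /H [V [F [oV Vy VA [FU Fu Fc]]]]; exists V; split => //; exists F; split.
- move=> U /FU [oU UD [q [qV qU cq]]]; split => //; split.
  + split; first by move=> x /qU [].
      move=> x x' /set_mem Ux /set_mem Ux' E.
      by rewrite -(qU _ Ux).2 E (qU _ Ux').2.
    by move=> w /qV [Uq pq]; exists (q w).
  + by apply/within_ccont => // x /UD /cp.
  + exists q; first exact/within_ccont.
    by move=> x /set_mem /qU [].
- by move=> U U' FU' FU'' [x [Ux U'x]]; exact: (Fu U U' x).
- apply/seteqP; split=> x.
    by move=> [Dx Vx]; have [U hU Ux] := Fc x Dx Vx; exists U.
  move=> [U hU Ux]; have [_ UD [q [_ qU _]]] := FU U hU.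
  by split; [exact: UD|exact: (qU x Ux).1].
Qed.

(** Here phi is a homeomorphism of D with inverse psi, and L one of the plane with inverse M. Evenly
    covered sets are pulled back by M, sheets by phi, and the new inverse branches are psi q M. *)
Lemma covering_transport D A p (phi psi L M : R[i] -> R[i]) : open D ->
  (forall x, D x -> ccont p x) -> covering_map D A p ->
  (forall x, D x -> [/\ D (phi x), D (psi x), phi (psi x) = x & psi (phi x) = x]) ->
  (forall x, D x -> ccont phi x /\ ccont psi x) ->
  (forall x, [/\ ccont L x, ccont M x, L (M x) = x & M (L x) = x]) ->
  covering_map D [set w | A (M w)] (fun x => L (p (phi x))).
Proof.
move=> oD cp cov hD cphi hL; have [_ pDA _] := cov.
apply: sheets_covering => //.
- move=> x Dx; have [Dp _ _ _] := hD x Dx.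
  apply: (@ccont_comp _ L (fun x => p (phi x))); first by have [] := hL (p (phi x)).
  by apply: ccont_comp; [exact: cp|exact: (cphi x Dx).1].
- apply/seteqP; split=> y /=.
    move=> [x Dx <-]; have [_ _ _ ->] := hL (p (phi x)).
    by rewrite -pDA; exists (phi x) => //; have [] := hD x Dx.
  rewrite -pDA => -[x Dx pxM]; have [_ Dpsi pp _] := hD x Dx.
  by exists (psi x) => //; rewrite pp pxM; have [] := hL y.
move=> y Ay; have [V [F [oV Vy VA [FU Fu Fc]]]] := covering_sheets cov Ay.
exists [set w | V (M w)], [set [set x | D x /\ U (phi x)] | U in F]; split => //.
- apply/open_discP => w Vw; have [_ cM _ _] := hL w.
  by have [d d0 hd] := ccont_nbhd oV Vw cM; exists d.
- by move=> w /VA.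
split.
- move=> _ [U hU <-]; have [oU UD [q [qV qU cq]]] := FU U hU; split.
  + apply/open_discP => x [Dx Ux].
    have [d d0 hd] := ccont_nbhd oU Ux (cphi x Dx).1.
    have [d' d'0 hd'] := (open_discP D).1 oD x Dx.
    exists (Num.min d d'); first by rewrite lt_min d0.
    by move=> w; rewrite lt_min => /andP[/hd hw /hd' hw'].
  + by move=> x [].
  + exists (fun w => psi (q (M w))); split=> [w Vw|x [Dx Ux]|w Vw].
    * have [Uq pq] := qV _ Vw; have Dq := UD _ Uq.
      have [_ Dpsi pp _] := hD _ Dq; have [_ _ LM _] := hL w.
      by rewrite /= pp pq LM.
    * have [Vx qx] := qU _ Ux; have [_ _ _ ML] := hL (p (phi x)).
      by have [_ _ _ pp] := hD x Dx; rewrite /= ML qx pp.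
    * have [Uq pq] := qV _ Vw; have Dq := UD _ Uq; have [_ cM _ _] := hL w.
      apply: (@ccont_comp _ psi (fun w => q (M w))); first exact: (cphi _ Dq).2.
      by apply: ccont_comp => //; exact: cq.
- move=> _ _ x [U hU <-] [U' hU' <-] [_ h1] [_ h2].
  by rewrite (Fu U U' (phi x)).
- move=> x Dx; have [_ _ _ ML] := hL (p (phi x)); rewrite /= ML => Vx.
  have [Dp _ _ _] := hD x Dx.
  by have [U hU Ux] := Fc _ Dp Vx; exists [set x | D x /\ U (phi x)] => //; exists U.
Qed.

Definition moebius (k z : R[i]) := (z + k) / (1 + conjc k * z).

Lemma cmod_sqr (a b : R) : cmod (Complex a b) ^+ 2 = a ^+ 2 + b ^+ 2.
Proof. by rewrite cmod_sqrt sqr_sqrtr // addr_ge0 ?sqr_ge0. Qed.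

(** This identity shows at once that the denominator has no zero in the disc and that [moebius k]
    maps the disc to itself. *)
Lemma moebius_cmod k z : cmod (1 + conjc k * z) ^+ 2 - cmod (z + k) ^+ 2 =
  (1 - cmod k ^+ 2) * (1 - cmod z ^+ 2).
Proof.
case: k z => a b [x y].
have -> : 1 + conjc (Complex a b) * Complex x y =
  Complex (1 + (a * x + b * y)) (a * y - b * x).
  by rewrite /conjc; simpc.
have -> : Complex x y + Complex a b = Complex (x + a) (y + b) by simpc.
by rewrite !cmod_sqr; ring.
Qed.

Lemma cmod_conj k : conjc k * k = (cmod k ^+ 2)%:C%C.
Proof.
case: k => a b; rewrite cmod_sqr /conjc; simpc; congr Complex; ring.
Qed.

Lemma moebius_den_neq0 k z : cmod k < 1 -> cmod z < 1 -> 1 + conjc k * z != 0.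
Proof.
move=> k1 z1; rewrite -cmod_gt0 lt_def cmod_ge0 andbT; apply/eqP => h.
have := moebius_cmod k z; rewrite h expr0n sub0r => H.
have k0 := cmod_ge0 k; have z0 := cmod_ge0 z.
have : 0 < (1 - cmod k ^+ 2) * (1 - cmod z ^+ 2).
  by rewrite mulr_gt0 // subr_gt0 exprn_ilt1.
by rewrite -H oppr_gt0 ltNge sqr_ge0.
Qed.

Lemma moebius_disc k z : cmod k < 1 -> cmod z < 1 -> cmod (moebius k z) < 1.
Proof.
move=> k1 z1; have dn := moebius_den_neq0 k1 z1.
rewrite /moebius cmodM cmodV ltr_pdivrMr ?cmod_gt0 // mul1r.
rewrite -(@ltr_pXn2r _ 2) ?nnegrE ?cmod_ge0 // -subr_gt0 moebius_cmod.
by rewrite mulr_gt0 // subr_gt0 exprn_ilt1 // cmod_ge0.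
Qed.

Lemma moebiusK k z : cmod k < 1 -> cmod z < 1 -> moebius (- k) (moebius k z) = z.
Proof.
move=> k1 z1; have dn := moebius_den_neq0 k1 z1.
have kn : 1 - conjc k * k != 0.
  rewrite cmod_conj -[1]/(1%:C%C) -realcB -cmod_gt0 cmod_real normr_gt0 subr_eq0.
  by rewrite gt_eqF // exprn_ilt1 // cmod_ge0.
have cN : conjc (- k) = - conjc k by rewrite rmorphN.
have E : 1 + conjc (- k) * moebius k z = (1 - conjc k * k) / (1 + conjc k * z).
  by rewrite cN /moebius; move: dn; move: (conjc k) => kc dn; field.
have E2 : moebius k z - k = z * (1 - conjc k * k) / (1 + conjc k * z).
  by rewrite /moebius; move: dn; move: (conjc k) => kc dn; field.
rewrite {1}/moebius E E2; move: dn kn; move: (conjc k) => kc dn kn.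
by field; rewrite dn kn.
Qed.

Lemma moebius_cderiv k z : cmod k < 1 -> cmod z < 1 ->
  cderiv (moebius k) z ((z + k) * (- (1 + conjc k * z) ^- 2 * conjc k) +
    (1 + conjc k * z)^-1).
Proof.
move=> k1 z1; have dn := moebius_den_neq0 k1 z1.
have d1 : cderiv (fun z => z + k) z 1.
  by apply: cderiv_eq (cderivD (cderivId _) (cderivC _ _)); rewrite addr0.
have d2 : cderiv (fun z => 1 + conjc k * z) z (conjc k).
  apply: cderiv_eq (cderivD (cderivC _ _) (cderivM (cderivC _ _) (cderivId _))).
  by rewrite mulr1 mulr0 addr0 add0r.
apply: cderiv_eq (cderivM d1 (cderivV (f := fun z => 1 + conjc k * z) dn d2)).
by rewrite mulr1.
Qed.

Lemma moebius_cderiv0 k : cmod k < 1 -> cderiv (moebius k) 0 (1 - cmod k ^+ 2)%:C%C.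
Proof.
move=> k1; apply: cderiv_eq (moebius_cderiv k1 _); last by rewrite cmod0.
rewrite mulr0 addr0 add0r expr1n invr1 mulN1r realcB -cmod_conj mulrN.
by rewrite addrC mulrC.
Qed.

End Transport.

(** * The hyperbolic density *)

Section Density.
Variable R : realType.
Implicit Types (r e d s t : R) (f g p q : R[i] -> R[i]) (z w c x y k : R[i]).
Implicit Types A : set R[i].

Definition hol_covering A z p :=
  [/\ holomorphic_on (disc 0 1) p, covering_map (disc 0 1) A p & p 0 = z].

Lemma hol_ccont A f z : holomorphic_on A f -> A z -> ccont f z.
Proof. by move=> hf Az; exact: cderiv_ccont (hol_cderiv hf Az). Qed.

Lemma disc0P r x : disc 0 r x <-> cmod x < r.
Proof. by rewrite /disc /= subr0. Qed.

Lemma covering_lift A p f z : hol_covering A z p -> holomorphic_on (disc 0 1) f ->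
  (forall x, disc 0 1 x -> A (f x)) -> f 0 = z ->
  exists g, [/\ holomorphic_on (disc 0 1) g, forall x, disc 0 1 x -> disc 0 1 (g x),
    forall x, disc 0 1 x -> p (g x) = f x, g 0 = 0 &
    forall x, disc 0 1 x -> derive1 p (g x) * derive1 g x = derive1 f x].
Proof.
move=> [hp cov p0] hf fA f0.
have D0 : disc (0 : R[i]) 1 0 by exact: disc_center.
have [|g lg g0] := lifting (x0 := 0) cov (fun x hx => hol_ccont hf hx) fA D0.
  by rewrite p0 f0.
have hg := lift_hol cov hp (@disc_open _ _ _) hf fA lg.
have [cg Dg pg] := lg; exists g; split => // x hx.
have [b b0 hb] := disc_open_nbhs ltr01 hx.
apply/esym/cderivE; apply: (@cderiv_near _ (fun x => p (g x)) _ _ _ b) => //.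
  by move=> y /hb /pg.
exact: cderiv_comp (hol_cderiv hp (Dg _ hx)) (hol_cderiv hg hx).
Qed.

Lemma covering_deriv_le A p1 p2 z : hol_covering A z p1 -> hol_covering A z p2 ->
  cmod (derive1 p1 0) <= cmod (derive1 p2 0).
Proof.
move=> [h1 c1 p10] hc2.
have [_ p1A _] := c1.
have [|g [hg gD _ g0 dg]] := covering_lift hc2 h1 _ p10.
  by move=> x hx; rewrite -p1A; exists x.
have D0 : disc (0 : R[i]) 1 0 by exact: disc_center.
have := dg 0 D0; rewrite g0 => <-; rewrite cmodM.
by rewrite ler_piMr ?cmod_ge0 //; exact: schwarz.
Qed.

Lemma density_eq A p z : hol_covering A z p ->
  hyperbolic_density A z = (cmod (derive1 p 0))^-1.
Proof.
move=> hp; rewrite /hyperbolic_density.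
set S := [set r | _].
have Sp : S (cmod (derive1 p 0))^-1.
  case: hp => hp cp p0; exists p; rewrite unit_discE; split => //.
  by rewrite div1r cmodE.
have [q [hq cq q0 ->]] := xgetPex 0 (ex_intro _ _ Sp).
rewrite unit_discE in hq cq; rewrite div1r -cmodE.
have hcq : hol_covering A z q by split.
have E : cmod (derive1 q 0) = cmod (derive1 p 0).
  apply/eqP; rewrite eq_le; apply/andP.
  by split; [exact: covering_deriv_le hcq hp|exact: covering_deriv_le hp hcq].
exact: (congr1 (fun t : R => t^-1) E).
Qed.

Lemma density_none A z : (forall p, ~ hol_covering A z p) -> hyperbolic_density A z = 0.
Proof.
move=> H; rewrite /hyperbolic_density; apply: xgetPN => r [p [hp cp p0 _]].
by apply: (H p); rewrite unit_discE in hp cp.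
Qed.

Lemma covering_affine A p z (l u : R[i]) x : hol_covering A z p -> l != 0 ->
  disc 0 1 x ->
  exists P, hol_covering [set w | A ((w - u) / l)] (u + l * p x) P /\
    derive1 P 0 = l * derive1 p x * (1 - cmod x ^+ 2)%:C%C.
Proof.
move=> [hp cov p0] l0 hx; have x1 := (disc0P 1 x).1 hx.
have nx1 : cmod (- x) < 1 by rewrite cmod_opp.
exists (fun w => u + l * p (moebius x w)).
have mD k w : cmod k < 1 -> disc 0 1 w -> disc 0 1 (moebius k w).
  by move=> k1 /disc0P w1; apply/disc0P/moebius_disc.
have dL w : cderiv (fun w => u + l * w) w l.
  apply: cderiv_eq (cderivD (cderivC _ _) (cderivM (cderivC _ _) (cderivId _))).
  by rewrite mulr1 mulr0 addr0 add0r.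
have dM w : cderiv (fun w => (w - u) / l) w l^-1.
  apply: cderiv_eq (cderivM (cderivD (cderivId _) (cderivC _ _)) (cderivC _ _)).
  by rewrite mulr0 add0r addr0 mulr1.
have m0 : moebius x 0 = x by rewrite /moebius mulr0 addr0 add0r divr1.
have dP w : disc 0 1 w -> exists2 m, cderiv (moebius x) w m &
    cderiv (fun w => u + l * p (moebius x w)) w (l * (derive1 p (moebius x w) * m)).
  move=> hw; have dm := moebius_cderiv x1 ((disc0P 1 w).1 hw).
  eexists; first exact: dm.
  have dpm := cderiv_comp (hol_cderiv hp (mD x w x1 hw)) dm.
  exact: (cderiv_comp (g := fun w => p (moebius x w)) (dL _) dpm).
split; first split.
- by apply: cderiv_hol => w /dP [m _ h]; eexists; exact: h.
- apply: (covering_transport (D := disc 0 1) (A := A) (p := p) (phi := moebius x)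
    (psi := moebius (- x)) (L := fun w => u + l * w) (M := fun w => (w - u) / l)) => //.
  + exact: disc_open.
  + by move=> y hy; exact: hol_ccont hp hy.
  + move=> y hy; have y1 := (disc0P 1 y).1 hy; split; [exact: mD|exact: mD| |].
      by rewrite -{1}[x]opprK moebiusK.
    by rewrite moebiusK.
  + move=> y /disc0P y1; split; apply: cderiv_ccont; exact: moebius_cderiv.
  + move=> y; split.
    * exact: cderiv_ccont (dL y).
    * exact: cderiv_ccont (dM y).
    * by rewrite mulrC divfK // addrC subrK.
    * by rewrite addrC addKr mulrC mulKf.
- by rewrite m0.
- apply: cderivE.
  have dm := moebius_cderiv0 x1.
  have D0 : disc (0 : R[i]) 1 0 by exact: disc_center.
  have dpm := cderiv_comp (hol_cderiv hp (mD x 0 x1 D0)) dm.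
  rewrite m0 in dpm.
  apply: cderiv_eq (cderiv_comp (g := fun w => p (moebius x w)) (dL _) dpm).
  by rewrite mulrA.
Qed.

Lemma quotient_estimate (K a b u n : R) : u <= 48 * n -> u <= 1 / 2 -> 0 <= u ->
  0 <= a -> a <= 48 -> `|a - b| <= K * n ->
  `|a / (1 - u ^+ 2) - b| <= (K + 48 * 48) * n.
Proof.
move=> gx gx2 gn dn dx L.
have q0 : 3 / 4 <= 1 - u ^+ 2 by nra.
have -> : a / (1 - u ^+ 2) - b = a * (u ^+ 2 / (1 - u ^+ 2)) + (a - b).
  by field; lra.
apply: le_trans (ler_normD _ _) _.
have q1 : u ^+ 2 / (1 - u ^+ 2) <= u.
  by rewrite ler_pdivrMr; [nra|lra].
have q2 : 0 <= u ^+ 2 / (1 - u ^+ 2).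
  by rewrite divr_ge0 ?sqr_ge0 //; lra.
rewrite ger0_norm; last by rewrite mulr_ge0.
have : a * (u ^+ 2 / (1 - u ^+ 2)) <= 48 * (48 * n).
  apply: ler_pM => //; lra.
lra.
Qed.

Lemma self_map_estimate : exists2 K : R, 0 < K & forall g,
  holomorphic_on (disc 0 1) g -> (forall x, disc 0 1 x -> disc 0 1 (g x)) -> g 0 = 0 ->
  forall x, cmod x <= 1 / 96 ->
  cmod (g x) < 1 /\
  `|cmod (derive1 g x) / (1 - cmod (g x) ^+ 2) - cmod (derive1 g 0)| <= K * cmod x.
Proof.
pose K1 : R := 24 * 48 * 8 * 1 / 1 ^+ 2.
have K10 : 0 < K1 by rewrite /K1 divr_gt0 ?expr1n //; lra.
exists (K1 + 48 * 48); first lra.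
move=> g hg gD g0 x hx.
have gM z : disc 0 1 z -> cmod (g z) <= 1.
  by move=> /gD /disc0P /ltW.
have r20 : 0 < 1 / 2 :> R by lra.
have r21 : 1 / 2 < 1 :> R by lra.
have fb := deriv_bound r20 r21 hg gM.
have e48 : 24 * 1 / (1 - 1 / 2) = 48 :> R by field.
rewrite e48 in fb.
have n0 := cmod_ge0 x.
have x2 : disc 0 (1 / 2) x by apply/disc0P; lra.
have x8 : disc 0 (1 / 8) x by apply/disc0P; lra.
have h2 : holomorphic_on (disc 0 (1 / 2)) g by apply: holS hg; apply: disc_subr; lra.
have gx : cmod (g x) <= 48 * cmod x.
  have := mean_value_disc h2 fb (disc_center _ r20) x2.
  by rewrite g0 !subr0.
have := deriv_lipschitz ltr01 hg gM (disc_center _ _) x8.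
rewrite -/K1 subr0 => /(_ ltac:(lra)) L.
have gx2 : cmod (g x) <= 1 / 2 by lra.
have gn := cmod_ge0 (g x).
split; first lra.
have dx := fb x x2.
have dn := cmod_ge0 (derive1 g x).
have L' := le_trans (cmod_abs_sub (derive1 g x) (derive1 g 0)) L.
exact: quotient_estimate.
Qed.

End Density.

(** * Twice punctured planes *)

Section PuncturedPlane.
Variable R : realType.
Implicit Types (a b z x l : R[i]) (d e s m : R).

Lemma punctured_plane_affine a b a' b' : a != b -> a' != b' ->
  let l := (b' - a') / (b - a) in
  [set w | (~` [set a; b]) ((w - (a' - l * a)) / l)] = ~` [set a'; b'].
Proof.
move=> ab a'b' l.
have ab0 : b - a != 0 by rewrite subr_eq0 eq_sym.
have a'b'0 : b' - a' != 0 by rewrite subr_eq0 eq_sym.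
have l0 : l != 0 by rewrite mulf_neq0 ?invr_eq0.
have E w c : (w - (a' - l * a)) / l = c <-> w = a' + l * (c - a).
  split=> [<-|->]; first by field; exact: l0.
  by field; exact: l0.
have Ea : a' + l * (a - a) = a' by rewrite subrr mulr0 addr0.
have Eb : a' + l * (b - a) = b' by rewrite /l divfK // addrC subrK.
apply/seteqP; split=> w /= H [h|h]; apply: H.
- by left; apply/E; rewrite Ea.
- by right; apply/E; rewrite Eb.
- by left; rewrite -Ea; apply/E.
- by right; rewrite -Eb; apply/E.
Qed.

Lemma plane_transfer a b a' b' p z0 x : a != b -> a' != b' ->
  hol_covering (~` [set a; b]) z0 p -> disc 0 1 x ->
  let l := (b' - a') / (b - a) in
  exists P, hol_covering (~` [set a'; b']) (a' + l * (p x - a)) P /\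
    derive1 P 0 = l * derive1 p x * (1 - cmod x ^+ 2)%:C%C.
Proof.
move=> ab a'b' hp hx l.
have l0 : l != 0 by rewrite mulf_neq0 ?invr_eq0 // subr_eq0 eq_sym.
have [P [hP dP]] := covering_affine (a' - l * a) hp l0 hx.
exists P; split=> //; move: hP; rewrite punctured_plane_affine //.
by have -> : a' - l * a + l * p x = a' + l * (p x - a) by ring.
Qed.

Lemma plane_covering_ex a b a' b' z0 z p : a != b -> a' != b' ->
  hol_covering (~` [set a; b]) z0 p -> z != a' -> z != b' ->
  exists P, hol_covering (~` [set a'; b']) z P.
Proof.
move=> ab a'b' hp za zb; set l := (b' - a') / (b - a).
have ab0 : b - a != 0 by rewrite subr_eq0 eq_sym.
have a'b'0 : b' - a' != 0 by rewrite subr_eq0 eq_sym.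
have l0 : l != 0 by rewrite mulf_neq0 ?invr_eq0.
have [_ [_ pA _] _] := hp.
have : (~` [set a; b]) (a + (z - a') / l).
  move=> /= [h|h].
    have : l * (a + (z - a') / l - a) = 0 by rewrite h subrr mulr0.
    have -> : l * (a + (z - a') / l - a) = z - a' by field.
    by move/eqP; rewrite subr_eq0 (negbTE za).
  have : l * (a + (z - a') / l - a) = l * (b - a) by rewrite h.
  have -> : l * (a + (z - a') / l - a) = z - a' by field.
  by rewrite /l divfK // => /addIr/eqP; rewrite (negbTE zb).
rewrite -pA => -[x hx px].
have [P [hP _]] := plane_transfer ab a'b' hp hx.
exists P; move: hP; rewrite px -/l.
by have -> : a' + l * (a + (z - a') / l - a) = z by field.
Qed.

Lemma inv_cmod_deriv (l D G : R[i]) (d c : R) : 0 < d -> 0 < c ->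
  D * G = d%:C%C -> (cmod (l * D * c%:C%C))^-1 = cmod G / c / (d * cmod l).
Proof.
move=> d0 c0 DG; rewrite !cmodM cmod_real gtr0_norm //.
have E : cmod D * cmod G = d by rewrite -cmodM DG cmod_real gtr0_norm.
have [l0|l0] := eqVneq (cmod l) 0; first by rewrite l0 mul0r mul0r mulr0 !invr0 mulr0.
have : cmod D * cmod G != 0 by rewrite E gt_eqF.
rewrite mulf_eq0 => /norP[D0 G0]; rewrite -E; field.
by rewrite l0 D0 G0 gt_eqF.
Qed.

Lemma rho_estimate_numeric (K b T d l n m k e : R) : 0 < K -> 0 < d -> 0 < m ->
  `|T - b| <= K * n -> 0 <= b <= 1 -> n <= k * e / d -> n <= 1 ->
  `|l - 1| <= 2 * e / m -> 4 * e <= m ->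
  `|b / d - T / (d * l)| <= ((1 + K) * (4 / m) + K * (k / d)) / d * e.
Proof.
move=> K0 d0 m0 Tb /andP[b0 b1] nk n1 l1 em.
have l2 : 2 * e / m <= 1 / 2 by rewrite ler_pdivrMr //; lra.
have l3 : 1 / 2 <= l by move: l1; rewrite ler_norml; lra.
have l0 : 0 < l by lra.
have -> : b / d - T / (d * l) = ((b - T) + T * ((l - 1) / l)) / d by field; lra.
rewrite normrM normfV (gtr0_norm d0) ler_pdivrMr //.
have -> : ((1 + K) * (4 / m) + K * (k / d)) / d * e * d =
  ((1 + K) * (4 / m) + K * (k / d)) * e by field; rewrite !gt_eqF.
apply: le_trans (ler_normD _ _) _; rewrite distrC normrM.
have T1 : `|T| <= 1 + K.
  have := ler_normD (T - b) b; rewrite subrK (ger0_norm b0).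
  have : K * n <= K * 1 by rewrite ler_wpM2l // ltW.
  lra.
have L : `|(l - 1) / l| <= 4 / m * e.
  rewrite normrM normfV (gtr0_norm l0) ler_pdivrMr //; apply: le_trans (l1) _.
  have em0 : 0 <= 2 * e / m by apply: le_trans (normr_ge0 _) (l1).
  have -> : 4 / m * e * l = 2 * e / m * (2 * l) by ring.
  by rewrite ler_peMr //; lra.
have A1 : `|T| * `|(l - 1) / l| <= (1 + K) * (4 / m * e) by apply: ler_pM.
have A2 : K * n <= K * (k * e / d) by rewrite ler_wpM2l // ltW.
have -> : ((1 + K) * (4 / m) + K * (k / d)) * e =
  K * (k * e / d) + (1 + K) * (4 / m * e) by ring.
lra.
Qed.

Lemma rho_estimate : exists2 K : R, 0 < K &
  forall a b a' b' z (s d e : R), 0 < d -> 0 < e ->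
  d <= cmod (z - a) -> d <= cmod (z - b) -> cmod (z - a) <= s ->
  4 * e <= cmod (a - b) -> cmod (a - a') < e -> cmod (b - b') < e ->
  2 * (1 + 2 * s / cmod (a - b)) * e / d <= 1 / 96 ->
  `|rho a b z - rho a' b' z| <=
    ((1 + K) * (4 / cmod (a - b)) +
     K * (2 * (1 + 2 * s / cmod (a - b)) / d)) / d * e.
Proof.
have [K K0 hK] := self_map_estimate R; exists K => //.
move=> a b a' b' z s d e d0 e0 da db sa; set m := cmod (a - b) => em aa bb small.
set k := 2 * (1 + 2 * s / m) in small *.
have m0 : 0 < m by lra.
have s0 : 0 <= s := le_trans (cmod_ge0 _) sa.
have ab0 : a - b != 0 by rewrite -cmod_gt0.
have ab : a != b by rewrite -subr_eq0.
have ba0 : b - a != 0 by rewrite subr_eq0 eq_sym.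
set l := (b' - a') / (b - a).
have l1 : cmod (l - 1) <= 2 * e / m.
  have -> : l - 1 = ((b' - b) + (a - a')) / (b - a) by rewrite /l; field.
  rewrite cmodM cmodV (cmod_sub b a) -/m ler_pM2r ?invr_gt0 //.
  apply: le_trans (cmodD _ _) _; rewrite (cmod_sub b' b).
  by clear -aa bb; lra.
have l2 : `|cmod l - 1| <= 2 * e / m.
  by have := cmod_abs_sub l 1; rewrite cmod1 => /le_trans; apply.
have e2m : 2 * e / m <= 1 / 2 by rewrite ler_pdivrMr //; clear -em; lra.
have l3 : 1 / 2 <= cmod l by move: l2; rewrite ler_norml; clear -e2m; lra.
have l0 : l != 0 by rewrite -cmod_gt0; clear -l3; lra.
have a'b' : a' != b'.
  by apply: contra_neq l0 => E; rewrite /l E subrr mul0r.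
have subD w : disc z d w -> (~` [set a; b]) w.
  by rewrite /disc /= => hw [h|h]; move: hw; rewrite h cmod_sub ltNge ?da ?db.
pose z1 := a + (z - a') / l.
have z1z : cmod (z1 - z) <= k * e.
  have -> : z1 - z = ((a - a') + (1 - l) * (z - a)) / l by rewrite /z1; field.
  rewrite cmodM cmodV ler_pdivrMr ?cmod_gt0 //.
  apply: le_trans (cmodD _ _) _; rewrite cmodM (cmod_sub 1).
  have A1 : cmod (l - 1) * cmod (z - a) <= 2 * e / m * s.
    by apply: ler_pM; rewrite ?cmod_ge0.
  have A2 : e + 2 * e / m * s = (k * e) * (1 / 2) by rewrite /k; field; rewrite gt_eqF.
  have A3 : (k * e) * (1 / 2) <= (k * e) * cmod l.
    rewrite ler_wpM2l // /k !mulr_ge0 //; last exact: ltW.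
    by rewrite addr_ge0 // divr_ge0 ?mulr_ge0 // ltW.
  move: A1 A2 A3 aa; clear; lra.
have dC : d%:C%C != 0 :> R[i] by rewrite -cmod_gt0 cmod_real gtr0_norm.
pose y := (z1 - z) / d%:C%C.
have yk : cmod y <= k * e / d.
  by rewrite /y cmodM cmodV cmod_real gtr0_norm // ler_pM2r ?invr_gt0.
have y96 : cmod y <= 1 / 96 := le_trans yk small.
have y1 : disc 0 1 y by apply/disc0P; clear -y96; lra.
have az : z != a by rewrite -subr_eq0 -cmod_gt0 (lt_le_trans d0).
have bz : z != b by rewrite -subr_eq0 -cmod_gt0 (lt_le_trans d0).
have fin : 0 <= ((1 + K) * (4 / m) + K * (k / d)) / d * e.
  have k0 : 0 <= k by rewrite mulr_ge0 // addr_ge0 // divr_ge0 ?mulr_ge0 // ltW.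
  rewrite !mulr_ge0 ?invr_ge0 ?(ltW d0) ?(ltW e0) //.
  rewrite addr_ge0 //; apply: mulr_ge0; rewrite ?divr_ge0 ?(ltW m0) ?(ltW d0) ?(ltW K0) //.
  by rewrite addr_ge0 // ltW.
rewrite /rho.
have [[p hp]|nop] := pselect (exists p, hol_covering (~` [set a; b]) z p); last first.
  rewrite !density_none ?subrr ?normr0 //.
    by move=> p hp; have [P hP] := plane_covering_ex a'b' ab hp az bz; apply: nop; exists P.
  by move=> p hp; apply: nop; exists p.
pose f w := z + d%:C%C * w.
have df w : cderiv f w d%:C%C.
  apply: cderiv_eq (cderivD (cderivC _ _) (cderivM (cderivC _ _) (cderivId _))).
  by rewrite mulr1 mulr0 addr0 add0r.
have [|x hx||g [hg gD pg g0 dpg]] := covering_lift (f := f) hp.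
- by apply: cderiv_hol => w _; exists d%:C%C.
- apply: subD; rewrite /disc /= /f addrAC subrr add0r cmodM cmod_real gtr0_norm //.
  by move/disc0P: hx => hx; rewrite -[ltRHS]mulr1 ltr_pM2l.
- by rewrite /f mulr0 addr0.
have D0 : disc (0 : R[i]) 1 0 by exact: disc_center.
have [gx1 gx2] := hK g hg gD g0 y y96.
have [P [hP dP]] := plane_transfer ab a'b' hp (gD y y1).
have fy : f y = z1 by rewrite /f /y mulrC divfK // addrC subrK.
have base : a' + l * (p (g y) - a) = z.
  by rewrite pg // fy /z1; field.
rewrite -/l base in hP; rewrite (density_eq hp) (density_eq hP) dP -/l.
have E1 := dpg y y1; rewrite (cderivE (df y)) in E1.
have E0 := dpg 0 D0; rewrite (cderivE (df 0)) g0 in E0.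
have c0 : 0 < 1 - cmod (g y) ^+ 2 by rewrite subr_gt0 exprn_ilt1 ?cmod_ge0.
rewrite (inv_cmod_deriv l d0 c0 E1).
have -> : (cmod (derive1 p 0))^-1 = cmod (derive1 g 0) / d.
  have := inv_cmod_deriv 1 d0 ltr01 E0.
  by rewrite mul1r mulr1 cmod1 divr1 mulr1.
have gs := schwarz hg gD g0.
apply: (rho_estimate_numeric (n := cmod y)) => //.
- by rewrite cmod_ge0.
- by apply: le_trans y96 _; clear; lra.
Qed.

End PuncturedPlane.

(** * Distances and compactness *)

Section Distances.
Variable R : realType.
Implicit Types (a b z w c : R[i]) (e r x : R) (A B K : set R[i]).

Lemma inf_lt_ex (E : set R) x : E !=set0 -> inf E < x -> exists2 y, E y & y < x.
Proof.
move=> E0 h; apply: contrapT => H; move: h; apply/negP; rewrite -leNgt.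
apply: lb_le_inf => // y Ey; rewrite leNgt; apply/negP => yx.
by apply: H; exists y.
Qed.

Lemma set_dist_lt_ex A B r : A !=set0 -> B !=set0 -> set_dist A B < r ->
  exists z w, [/\ A z, B w & cmod (z - w) < r].
Proof.
move=> [z Az] [w Bw] /inf_lt_ex [|_ [u Au [v Bv <-]]].
  by exists (normc (z - w)); exists z => //; exists w.
by rewrite -cmodE => h; exists u, v.
Qed.

Lemma set_dist_le A B z w : A z -> B w -> set_dist A B <= cmod (z - w).
Proof.
move=> Az Bw; apply: ge_inf; last by exists z => //; exists w; rewrite ?cmodE.
by exists 0 => _ [u _ [v _ <-]]; rewrite -cmodE cmod_ge0.
Qed.

Lemma hausdorff_lt_ex a b a' b' e :
  hausdorff_dist [set a; b] [set a'; b'] < e -> forall c, [set a; b] c ->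
  exists2 c', [set a'; b'] c' & cmod (c - c') < e.
Proof.
have n0 A B z w : A z -> B w -> set_dist [set z] B <= cmod (z - w).
  by move=> _ Bw; exact: set_dist_le.
move=> /inf_lt_ex [|r [r0 h1 h2] re c /h1].
  pose r := 1 + cmod (a - a') + cmod (b - a') + cmod (a' - a) + cmod (b' - a).
  have := cmod_ge0 (a - a'); have := cmod_ge0 (b - a').
  have := cmod_ge0 (a' - a); have := cmod_ge0 (b' - a) => p1 p2 p3 p4.
  have ma : [set a; b] a by left.
  have ma' : [set a'; b'] a' by left.
  exists r; split; first by rewrite /r; lra.
  - move=> c [->|->]; rewrite /set_nbhd /=.
      have := @set_dist_le [set a] _ a a' erefl ma'; rewrite /r; lra.
    have := @set_dist_le [set b] _ b a' erefl ma'; rewrite /r; lra.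
  - move=> c [->|->]; rewrite /set_nbhd /=.
      have := @set_dist_le [set a'] _ a' a erefl ma; rewrite /r; lra.
    have := @set_dist_le [set b'] _ b' a erefl ma; rewrite /r; lra.
rewrite /set_nbhd /= => /set_dist_lt_ex [||z [w [-> hw h]]].
- by exists c.
- by exists a'; left.
- by exists w => //; exact: lt_trans re.
Qed.

Lemma hausdorff_pairing a b a' b' e : 4 * e <= cmod (a - b) ->
  hausdorff_dist [set a; b] [set a'; b'] < e ->
  cmod (a - a') < e /\ cmod (b - b') < e \/ cmod (a - b') < e /\ cmod (b - a') < e.
Proof.
move=> em H.
have [c [->|->] ha] := hausdorff_lt_ex H (or_introl erefl);
  have [c' [->|->] hb] := hausdorff_lt_ex H (or_intror erefl); try by [left|right].
  have := cmod_dist_trans a' a b; rewrite (cmod_sub a' b).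
  by have := cmod_ge0 (a - a'); lra.
have := cmod_dist_trans b' a b; rewrite (cmod_sub b' b).
by have := cmod_ge0 (a - b'); lra.
Qed.

Lemma compact_cmod K c : compact K -> compact [set cmod (z - c) | z in K].
Proof.
move=> cK; apply: (continuous_compact (f := fun z => cmod (z - c))) cK.
apply: continuous_subspaceT => z.
apply/(@cvgrPdist_lt _ _ _ _ (nbhs_filter z)) => e e0.
apply/nbhs_discP; exists e => // w hw.
apply: le_lt_trans (cmod_abs_sub _ _) _.
by rewrite opprB addrA subrK cmod_sub.
Qed.

Lemma compact_cmod_le K c : compact K -> exists M, forall z, K z -> cmod (z - c) <= M.
Proof.
move=> cK; have [M [_ hM]] := compact_bounded (compact_cmod (c := c) cK).
exists (M + 1) => z Kz; have := hM (M + 1); rewrite ltrDl ltr01 => /(_ isT).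
by move=> /(_ (cmod (z - c))) /=; rewrite ger0_norm ?cmod_ge0 //; apply; exists z.
Qed.

Lemma compact_cmod_ge K c : compact K -> ~ K c ->
  exists2 e, 0 < e & forall z, K z -> e <= cmod (z - c).
Proof.
move=> cK Kc.
have := compact_closed (@Rhausdorff R) (compact_cmod (c := c) cK).
rewrite -openC => oC.
have n0 : (~` [set cmod (z - c) | z in K]) 0.
  by move=> [z Kz /eqP]; rewrite cmod_eq0 subr_eq0 => /eqP zc; apply: Kc; rewrite -zc.
have /nbhs_ballP [e /= e0 he] := open_nbhs_nbhs (conj oC n0).
exists e => // z Kz; rewrite leNgt; apply/negP => h.
apply: (he (cmod (z - c))); last by exists z.
by rewrite /ball /= sub0r normrN ger0_norm ?cmod_ge0.
Qed.

End Distances.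

Theorem theorem3 (R : realType) :
  exists C : R -> R -> R -> R,
  forall (a b : R[i]) (K : set R[i]),
    a <> b -> compact K -> K `<=` ~` [set a; b] ->
  exists eps0 : R, 0 < eps0 /\
  forall eps : R, 0 < eps -> eps < eps0 ->
  forall a' b' : R[i],
    hausdorff_dist [set a; b] [set a'; b'] < eps ->
  forall z : R[i], K z ->
    `| rho a b z - rho a' b' z | <
      C (sup [set x | exists2 w, K w & x = normc (w - a) \/ x = normc (w - b)])
        (set_dist K [set a; b])
        (normc (a - b)) * eps * ln (1 / eps).
Proof.
have [k k0 hk] := rho_estimate R.
exists (fun s d m => ((1 + k) * (4 / m) + k * (2 * (1 + 2 * s / m) / d)) / d + 1).
move=> a b K ab cK KU.
have [[z0 Kz0]|K0] := pselect (K !=set0); last first.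
  by exists 1; split => // e _ _ a' b' _ z Kz; case: K0; exists z.
set s := sup _; set d := set_dist _ _; set m := normc _.
have m0 : 0 < m.
  by rewrite /m -cmodE cmod_gt0 subr_eq0; apply/eqP.
have Ka : ~ K a by move=> /KU; apply; left.
have Kb : ~ K b by move=> /KU; apply; right.
have d0 : 0 < d.
  have [ea ea0 ha] := compact_cmod_ge cK Ka.
  have [eb eb0 hb] := compact_cmod_ge cK Kb.
  apply: (@lt_le_trans _ _ (Num.min ea eb)); first by rewrite lt_min ea0.
  apply: lb_le_inf; first by exists (normc (z0 - a)), z0 => //; exists a => //; left.
  move=> _ [z Kz [w [->|->] <-]]; rewrite -cmodE ge_min ?ha ?hb ?orbT //.
have ds z : K z -> [/\ d <= cmod (z - a), d <= cmod (z - b) & cmod (z - a) <= s].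
  move=> Kz; split.
  - by apply: set_dist_le => //; left.
  - by apply: set_dist_le => //; right.
  - apply: ub_le_sup; last by exists z => //; left; rewrite cmodE.
    have [Ma hMa] := compact_cmod_le a cK.
    have [Mb hMb] := compact_cmod_le b cK.
    exists (Num.max Ma Mb) => _ [w Kw [->|->]]; rewrite -cmodE le_max.
      by rewrite hMa.
    by rewrite hMb ?orbT.
have s0 : 0 <= s by have [_ _] := ds z0 Kz0; apply: le_trans; exact: cmod_ge0.
have q0 : 0 < 2 * (1 + 2 * s / m) by rewrite mulr_gt0 // ltr_pwDl // divr_ge0 ?mulr_ge0 // ltW.
set Q := 2 * (1 + 2 * s / m) in q0 *.
exists (Num.min (expR (-1)) (Num.min (m / 4) (d / (96 * Q)))); split.
  by rewrite !lt_min expR_gt0 !divr_gt0 // mulr_gt0.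
move=> e e0; rewrite !lt_min => /andP[e1 /andP[e2 e3]] a' b' H z Kz.
have [da db sa] := ds z Kz.
have em : 4 * e <= cmod (a - b) by rewrite cmodE -/m; lra.
have ed : Q * e / d <= 1 / 96.
  have e4 : e * (96 * Q) < d by rewrite -ltr_pdivlMr // mulr_gt0.
  have num (x : R) : e * (96 * x) < d -> x * e <= 1 / 96 * d.
    by rewrite mulrCA [e * x]mulrC => h; clear -h; lra.
  by rewrite ler_pdivrMr //; exact: num.
set Z := ((1 + k) * (4 / m) + k * (Q / d)) / d.
have Z0 : 0 <= Z.
  rewrite /Z mulr_ge0 ?invr_ge0 ?(ltW d0) // addr_ge0 //.
    by rewrite mulr_ge0 // ?divr_ge0 ?(ltW m0) // addr_ge0 // ltW.
  by rewrite mulr_ge0 ?(ltW k0) // divr_ge0 // ltW.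
have est : `|rho a b z - rho a' b' z| <= Z * e.
  have E := hk a b _ _ z s d e d0 e0 da db sa em.
  have [[h1 h2]|[h1 h2]] := hausdorff_pairing em H.
    by have := E a' b' h1 h2; rewrite cmodE; apply.
  have -> : rho a' b' z = rho b' a' z by rewrite /rho setUC.
  by have := E b' a' h1 h2; rewrite cmodE; apply.
have l1 : 1 < ln (1 / e).
  rewrite div1r lnV ?posrE // ltrNr.
  by rewrite -[X in _ < X]expRK ltr_ln ?posrE ?expR_gt0.
apply: le_lt_trans est _.
apply: (@lt_le_trans _ _ ((Z + 1) * e)); first by rewrite ltr_pM2r //; lra.
by rewrite ler_peMr ?(ltW l1) // mulr_ge0 ?(ltW e0) //; lra.
Qed.
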